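(* Let $g\ge 3$ and let $\mathcal{C}$ be a non-hyperelliptic connected component of the minimal stratum $\mathcal{H}(2g-2)$. Let $\pi$ be a permutation in a Rauzy class representing $\mathcal{C}$ (so $|\mathcal{A}|=2g$ and $\Omega_\pi$ is a unimodular symplectic form on $\mathbb{Z}^{\mathcal{A}}$). Then $$\mathrm{RV}(\pi)=\{S\in\mathrm{Sp}(\Omega_\pi,\mathbb{Z}) : \overline{S}\in O(Q_\pi)\},$$ i.e. $\mathrm{RV}(\pi)$ is the preimage of $O(Q_\pi)$ under the modulus-two reduction $\mathrm{Sp}(\Omega_\pi,\mathbb{Z})\to\mathrm{Sp}(\overline{\Omega}_\pi,\mathbb{Z}/2\mathbb{Z})$.
   Context: Permutations. Let $\mathcal{A}$ be a finite alphabet with $d=|\mathcal{A}|\ge 3$. A permutation is a pair $\pi=(\pi_{\mathrm t},\pi_{\mathrm b})$ of bijections $\mathcal{A}\to\{1,\dots,d\}$; write $\alpha_{\varepsilon,j}=\pi_\varepsilon^{-1}(j)$. Permutations are assumed irreducible ($\pi_{\mathrm t}^{-1}(\{1,\dots,j\})\ne\pi_{\mathrm b}^{-1}(\{1,\dots,j\})$ for $1\le j<d$) and nondegenerate (no $1\le j<d$ satisfies any of: (i) $\pi_{\mathrm b}(\alpha_{\mathrm t,j})=d$, $\pi_{\mathrm b}(\alpha_{\mathrm t,j+1})=1$, $\pi_{\mathrm b}(\alpha_{\mathrm t,1})=\pi_{\mathrm b}(\alpha_{\mathrm t,d})+1$; (ii) $\pi_{\mathrm b}(\alpha_{\mathrm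 t,j+1})=1$, $\pi_{\mathrm b}(\alpha_{\mathrm t,1})=\pi_{\mathrm b}(\alpha_{\mathrm t,j})+1$; (iii) $\pi_{\mathrm b}(\alpha_{\mathrm t,j})=d$, $\pi_{\mathrm b}(\alpha_{\mathrm t,j+1})=\pi_{\mathrm b}(\alpha_{\mathrm t,d})+1$). Rauzy induction: the top operation, with $\alpha_{\mathrm b,k}=\alpha_{\mathrm t,d}$, replaces the bottom row by $\alpha_{\mathrm b,1},\dots,\alpha_{\mathrm b,k},\alpha_{\mathrm b,d},\alpha_{\mathrm b,k+1},\dots,\alpha_{\mathrm b,d-1}$ (winner $\alpha_{\mathrm t,d}$, loser $\alpha_{\mathrm b,d}$); the bottom operation, with $\alpha_{\mathrm t,k}=\alpha_{\mathrm b,d}$, replaces the top row by $\alpha_{\mathrm t,1},\dots,\alpha_{\mathrm t,k},\alpha_{\mathrm t,d},\alpha_{\mathrm t,k+1},\dots,\alpha_{\mathrm t,d-1}$ (winner $\alpha_{\mathrm b,d}$, loser $\alpha_{\mathrm t,d}$). Rauzy classes are connected components of the resulting directed graph; each corresponds to a connected component of a stratum of translation surfaces containing the suspensions $M_\pi$ of its permutations. $(\Omega_\pi)_{\alpha\beta}=+1$ if $\pi_{\mathrm t}(\alpha)<\pi_{\mathrm t}(\beta)$ and $\pi_{\mathrm b}(\alpha)>\pi_{\mathrm b}(\beta)$, $-1$ if the reverse inequalities hold, $0$ otherwise. For an arrow $\gamma$ with winner $\alpha_{\mathrm w}$, loser $\alpha_{\mathrm l}$, $B_\gamma=\mathrm{Id}+E_{\alpha_{\mathrm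 l}\alpha_{\mathrm w}}$, $B_{\gamma^{-1}}=B_\gamma^{-1}$, and $B_{\gamma_1\cdots\gamma_n}=B_{\gamma_n}\cdots B_{\gamma_1}$. $\mathrm{RV}(\pi)$ is the group of $B_\gamma$ over closed walks $\gamma$ (arrows and reversed arrows) at $\pi$, a subgroup of $\mathrm{Sp}(\Omega_\pi,\mathbb{Z})=\{S: S\Omega_\pi S^{\intercal}=\Omega_\pi\}$ acting on row vectors. Quadratic form: a bar denotes reduction mod $2$. For $u\in(\mathbb{Z}/2\mathbb{Z})^{\mathcal{A}}$, $Q_\pi(u)=\sum_{\pi_{\mathrm t}(\alpha)<\pi_{\mathrm t}(\beta)}u_\alpha(\Omega_\pi)_{\alpha\beta}u_\beta+\sum_{\alpha}u_\alpha \bmod 2$ (the usual quadratic form on mod-2 homology). $O(Q_\pi)$ is the group of invertible linear maps $S$ of $(\mathbb{Z}/2\mathbb{Z})^{\mathcal{A}}$ (row action) with $Q_\pi(uS)=Q_\pi(u)$ for all $u$. The non-hyperelliptic components of $\mathcal{H}(2g-2)$ are $\mathcal{H}(2g-2)^{\mathrm{odd}}$ for $g\ge3$ and $\mathcal{H}(2g-2)^{\mathrm{even}}$ for $g\ge4$ (Kontsevich–Zorich classification). *)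

(* Defs.v *)
From mathcomp Require Import all_boot all_fingroup all_algebra.
Set Implicit Arguments. Unset Strict Implicit. Unset Printing Implicit Defensive.
Import GRing.Theory.

(* Alphabet = 'I_n (a finite set with n letters); positions are 0-based:
   val (p.1 a) = pi_t(a) - 1 and val (p.2 a) = pi_b(a) - 1. *)
Definition iperm (n : nat) := ({perm 'I_n} * {perm 'I_n})%type.

Section Defs.
Variable n : nat.
Implicit Types (p q : iperm n).

Definition pt p (a : 'I_n) : nat := val (p.1 a).
Definition pb p (a : 'I_n) : nat := val (p.2 a).

Definition perm_irreducible p : bool :=
  [forall j : 'I_n, (0 < val j) ==>
     ([set a | pt p a < val j] != [set a | pb p a < val j])].

Definition perm_nondegenerate p : bool :=
  ~~ [exists a, exists b, exists f, exists l,
       [&& pt p b == (pt p a).+1, pt p f == 0, pt p l == n.-1 &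
        [|| [&& pb p a == n.-1, pb p b == 0 & pb p f == (pb p l).+1],
            [&& pb p b == 0 & pb p f == (pb p a).+1] |
            [&& pb p a == n.-1 & pb p b == (pb p l).+1]]]].

(* new position of a letter at position x when the last letter is inserted
   right after position k *)
Definition rshift (k x : nat) : nat :=
  if x <= k then x else if x == n.-1 then k.+1 else x.+1.

Definition top_step p q (w l : 'I_n) : bool :=
  [&& perm_irreducible p, pt p w == n.-1, pb p l == n.-1, q.1 == p.1 &
      [forall a, pb q a == rshift (pb p w) (pb p a)]].

Definition bot_step p q (w l : 'I_n) : bool :=
  [&& perm_irreducible p, pb p w == n.-1, pt p l == n.-1, q.2 == p.2 &
      [forall a, pt q a == rshift (pt p w) (pt p a)]].

Definition rauzy_arrow p q (w l : 'I_n) : bool := top_step p q w l || bot_step p q w l.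

Definition rauzy_adj : rel (iperm n) :=
  fun p q => [exists w, exists l, rauzy_arrow p q w l || rauzy_arrow q p w l].

Definition rauzy_class p q : bool := connect rauzy_adj p q.

Definition Bmx (w l : 'I_n) : 'M[int]_n := (1%:M + delta_mx l w)%R.

(* rauzy_walk p q M : there is a walk (arrows and reversed arrows) from p to q
   with B_gamma = M, where B_{gamma_1 ... gamma_k} = B_{gamma_k} ... B_{gamma_1}. *)
Inductive rauzy_walk p : iperm n -> 'M[int]_n -> Prop :=
| rwalk_nil : rauzy_walk p p (1%:M)%R
| rwalk_fwd q r w l M : rauzy_walk p q M -> rauzy_arrow q r w l ->
    rauzy_walk p r (Bmx w l *m M)
| rwalk_bwd q r w l M : rauzy_walk p q M -> rauzy_arrow r q w l ->
    rauzy_walk p r (invmx (Bmx w l) *m M)%R.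

Definition RV p : 'M[int]_n -> Prop := fun S => rauzy_walk p p S.

Definition Omega p : 'M[int]_n :=
  \matrix_(a, b)
    (if (pt p a < pt p b) && (pb p b < pb p a) then 1%R
     else if (pt p b < pt p a) && (pb p a < pb p b) then (-1)%R else 0%R) : 'M[int]_n.

Definition in_Sp p (S : 'M[int]_n) : Prop :=
  (S *m Omega p *m S^T)%R = Omega p.

Definition mod2 (S : 'M[int]_n) : 'M['F_2]_n := map_mx (fun z : int => (z%:~R)%R) S.

Definition Qform p (u : 'rV['F_2]_n) : 'F_2 :=
  (\sum_(a : 'I_n) \sum_(b : 'I_n | (pt p a < pt p b)%N)
      u 0 a * (Omega p a b)%:~R * u 0 b + \sum_(a : 'I_n) u 0 a)%R.

Definition in_OQ p (T : 'M['F_2]_n) : bool :=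
  (T \in unitmx) && [forall u : 'rV['F_2]_n, Qform p (u *m T)%R == Qform p u].

Definition symmetric_perm p : bool := [forall a, pb p a == n.-1 - pt p a].

(* With d = 2g letters: genus = rank(Omega)/2 and #singularities = d - 2g + 1,
   so the suspensions of (perm_nondegenerate) p lie in H(2g-2) iff Omega is invertible. *)
Definition minimal_stratum_perm (g : nat) p : Prop :=
  n = (2 * g)%N /\ (\det (Omega p) != 0)%R.

(* The Rauzy class of p represents the hyperelliptic component iff it contains
   the symmetric permutation (Veech, Kontsevich-Zorich). *)
Definition hyperelliptic_class p : bool := [exists q, rauzy_class p q && symmetric_perm q].

End Defs.

(* Main.v *)
From mathcomp Require Import all_boot all_order all_fingroup all_algebra.
From mathcomp Require Import ring zify.
Require Import Defs.
Set Implicit Arguments. Unset Strict Implicit. Unset Printing Implicit Defensive.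
Import GRing.Theory Num.Theory Order.TTheory.

(* A cycle of top (or bottom) operations with winner [w] is the symplectic
   transvection along [e_w].  By irreducibility every letter can be brought to the
   last position of some row before it ever loses, so all the transvections along
   the basis vectors lie in RV(pi).  The Rauzy class contains a standard
   permutation, whose extreme letters A and Z cross every other letter; it is not
   symmetric, so two of its letters do not cross.  The rest is about the group G
   generated by these transvections.

   Modulo 2: write H for the plane spanned by A and Z and W for its orthogonal
   complement.  The set R of singular w in W such that w + h is in the orbit of A
   for all h in H \ 0 is closed under sums of orthogonal vectors; as soon as it
   contains two orthogonal vectors, every vector of W is a sum of two elements of
   R, and the orbit of A is {Q = 1}.  A Cartan-Dieudonne argument then shows that G
   maps onto O(Q).

   Over the integers: the map E(x, y) : u |-> u + 2 <u, x> y + 2 <u, y> x, for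
   orthogonal x and y, lies in G when the transvections along x, y and a common
   neighbour do, hence for x = A and every y.  Euclid's algorithm with even
   quotients shows that G is transitive on the primitive vectors with Q = 1, so that
   G contains all squares of transvections, and the same algorithm shows that those
   generate the congruence subgroup of level 2. *)

(** * Quadratic spaces over a field with two elements *)

Section CharTwo.
Local Open Scope ring_scope.
Variables (V : finZmodType) (adj : V -> V -> bool) (Q : V -> bool).
Hypothesis addvv : forall v : V, v + v = 0.
Hypothesis adjDl : forall u v w, adj (u + v) w = adj u w (+) adj v w.
Hypothesis adjC : forall u v, adj u v = adj v u.
Hypothesis adjvv : forall v, adj v v = false.
Hypothesis QD : forall u v, Q (u + v) = Q u (+) Q v (+) adj u v.

Lemma adjDr u v w : adj u (v + w) = adj u v (+) adj u w.
Proof. by rewrite adjC adjDl !(adjC u). Qed.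

Lemma adj0l u : adj 0 u = false.
Proof. by rewrite -(addvv 0) adjDl addbb. Qed.

Lemma quad0 : Q 0 = false.
Proof. by rewrite -(addvv 0) QD addbb adj0l. Qed.

Lemma addvK (u v : V) : u + v + v = u.
Proof. by rewrite -addrA addvv addr0. Qed.

Lemma oppv (v : V) : - v = v.
Proof. by apply/eqP; rewrite eq_sym -addr_eq0 addvv. Qed.

Lemma addv_eq0 (u v : V) : (u + v == 0) = (u == v).
Proof. by rewrite addr_eq0 oppv. Qed.

(** * Nonsingular vectors generated by sums of adjacent ones *)

Section Generation.
Variables (D : V -> Prop) (a z : V).
Hypothesis D_add : forall x y, D x -> D y -> adj x y -> D (x + y).
Hypotheses (Da : D a) (Dz : D z) (adj_az : adj a z) (Qa : Q a) (Qz : Q z).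

Definition perp_az (v : V) : bool := ~~ adj v a && ~~ adj v z.

(** Of the three translates by nonzero vectors of the plane of [a] and [z], only [v + a] is
    required; [sing_add_az] and [sing_add_z] recover the other two. *)
Definition sing (v : V) : Prop := [/\ adj v a = false, adj v z = false, Q v = false & D (v + a)].

Let adj_za : adj z a. Proof. by rewrite adjC. Qed.

Lemma sing0 : sing 0.
Proof. by split; rewrite ?adj0l ?quad0 ?add0r. Qed.

Lemma sing_add_az v : sing v -> D (v + a + z).
Proof. by case=> va vz _ Dv; apply: D_add => //; rewrite adjDl vz adj_az. Qed.

Lemma sing_add_z v : sing v -> D (v + z).
Proof.
move=> sv; have := D_add (sing_add_az sv) Da.
rewrite !adjDl adjvv adj_za; case: sv => -> _ _ _ /(_ isT).
by rewrite (addrAC v a z) addvK.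
Qed.

(** [x + y + a] is the sum of [x + z] and [y + a + z], which are adjacent because [z] meets [a]. *)
Lemma sing_add x y : sing x -> sing y -> adj x y = false -> sing (x + y).
Proof.
move=> sx sy xy; case: (sx) => xa xz Qx Dx; case: (sy) => ya yz Qy Dy.
split; rewrite ?adjDl ?QD ?xa ?xz ?ya ?yz ?Qx ?Qy ?xy //.
have := D_add (sing_add_z sx) (sing_add_az sy).
rewrite !adjDl !adjDr adjvv xy xa xz adj_za (adjC z y) yz => /(_ isT).
by rewrite addrACA addvv addr0 addrA.
Qed.

Lemma sing_adj x y : sing x -> sing y -> adj x y -> D (x + y).
Proof.
move=> sx sy xy; case: (sx) => xa xz Qx Dx; case: (sy) => ya yz Qy Dy.
have := D_add Dx Dy.
rewrite !adjDl !adjDr adjvv xy xa (adjC a y) ya => /(_ isT).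
by rewrite addrACA addvv addr0.
Qed.

Definition sing2 (v : V) : Prop := exists x y, [/\ sing x, sing y & v = x + y].

(** Adding [s], [r], [q] to [p] in this order is a sum of orthogonal vectors at each stage, and a
    second copy of [s] then cancels the first. *)
Lemma sing2_adj_one p q r s : sing p -> sing q -> sing r -> sing s ->
  adj p q -> adj p r -> adj q r ->
  adj s p = false -> adj s q = false -> adj s r -> sing2 (p + q + r).
Proof.
move=> sp sq sr ss pq pr qr xp xq xr.
have ps : sing (p + s) by apply: sing_add => //; rewrite adjC.
have psr : sing (p + s + r) by apply: sing_add; rewrite // adjDl pr xr.
have psrq : sing (p + s + r + q).
  by apply: sing_add; rewrite // !adjDl pq xq (adjC r) qr.
exists (p + s + r + q), s; split=> //.
by rewrite (addrAC p s) (addrAC _ s q) addvK (addrAC p r).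
Qed.

Hypothesis sing_nondeg : forall v, perp_az v -> v != 0 -> exists2 x, sing x & adj x v.
Variables (x0 y0 : V).
Hypotheses (sx0 : sing x0) (sy0 : sing y0) (adj_xy0 : adj x0 y0 = false).
Hypotheses (x0n0 : x0 != 0) (y0n0 : y0 != 0) (xy0 : x0 != y0).

Lemma sing_not_isolated x :
  exists y, [/\ sing y, y != 0, y != x & adj x y = false].
Proof.
have [x0x|x0x] := boolP (adj x x0); last first.
  have [e|ne] := eqVneq x0 x; first by exists y0; rewrite -e; split; rewrite // eq_sym.
  by exists x0; rewrite (negbTE x0x).
have [y0x|y0x] := boolP (adj x y0); last first.
  have [e|ne] := eqVneq y0 x; last by exists y0; rewrite (negbTE y0x).
  by move: x0x; rewrite -e adjC adj_xy0.
exists (x0 + y0); split; first exact: sing_add.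
- by rewrite addv_eq0.
- by apply: contraTneq x0x => <-; rewrite adjDl adjvv adjC adj_xy0.
by rewrite adjDr x0x y0x.
Qed.

(* [Q (p + q + r) = 1], and an [s] meeting it in the pattern (1,0,0) suffices.
   If only (1,1,1) occurs, shifting two of the three by a [y] orthogonal to all
   of them turns (1,1,1) into (0,0,1). *)
Lemma sing2_add3 p q r : sing p -> sing q -> sing r ->
  adj p q -> adj p r -> adj q r -> sing2 (p + q + r).
Proof.
move=> sp sq sr pq pr qr.
have key p' q' r' s : sing p' -> sing q' -> sing r' ->
    adj p' q' -> adj p' r' -> adj q' r' -> sing s ->
    adj s (p' + q' + r') -> ~~ [&& adj s p', adj s q' & adj s r'] ->
    sing2 (p' + q' + r').
  move=> sp' sq' sr' pq' pr' qr' ss; rewrite !adjDr.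
  case E1: (adj s p'); case E2: (adj s q'); case E3: (adj s r') => //= _ _.
  - rewrite -addrA addrC; apply: (@sing2_adj_one _ _ _ s) => //; first by rewrite adjC.
    by rewrite adjC.
  - rewrite addrAC; apply: (@sing2_adj_one _ _ _ s) => //; by rewrite adjC.
  - exact: (@sing2_adj_one _ _ _ s).
set v := p + q + r.
have [[[pa pz Qp _] [qa qz Qq _]] [ra rz Qr _]] := (sp, sq, sr).
have vn0 : v != 0.
  apply/eqP=> v0; move: quad0; rewrite -v0 !QD Qp Qq Qr adjDl pq pr qr.
  by [].
have [x sx xv] : exists2 x, sing x & adj x v.
  by apply: sing_nondeg => //; rewrite /perp_az !adjDl pa pz qa qz ra rz.
have [/and3P[xp xq xr]|nall] := boolP [&& adj x p, adj x q & adj x r]; last exact: (key _ _ _ x).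
have [y [sy yn0 yx xy yv]] : exists y, [/\ sing y, y != 0, y != x, adj x y = false & adj y v = false].
  have [y [sy yn0 yx xy]] := sing_not_isolated x.
  case yv: (adj y v); last by exists y.
  exists (x + y); split.
  - exact: sing_add.
  - by rewrite addv_eq0 eq_sym.
  - by apply: contraNneq yn0 => e; rewrite -(addvK y x) [y + x]addrC e addvv.
  - by rewrite adjDr adjvv xy.
  by rewrite adjDl xv yv.
have sxy : sing (x + y) by exact: sing_add.
have xyv : adj (x + y) v by rewrite adjDl xv yv.
have [/and3P[xyp xyq xyr]|nall] := 
  boolP [&& adj (x + y) p, adj (x + y) q & adj (x + y) r]; last exact: (key _ _ _ (x + y)).
move: xyp xyq xyr; rewrite !adjDl xp xq xr /= => /negbTE yp /negbTE yq /negbTE yr.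
have [ya yz _ _] := sy.

(* Both [x] and [x + y] meet [v] and are orthogonal to [y]; adding whichever is orthogonal to [u]
   repairs the pairing of [u] with [v]. *)
have [u [su uy uv]] : exists u, [/\ sing u, adj u y & adj u v].
  have [u su uy] : exists2 u, sing u & adj u y.
    by apply: sing_nondeg => //; rewrite /perp_az ya yz.
  case uv: (adj u v); first by exists u.
  case ux: (adj u x).
    exists (u + (x + y)); split; first by apply: sing_add; rewrite // adjDr ux uy.
      by rewrite !adjDl uy xy adjvv.
    by rewrite adjDl uv xyv.
  exists (u + x); split; first exact: sing_add.
    by rewrite adjDl uy xy.
  by rewrite adjDl uv xv.
have [/and3P[up uq ur]|nall] := boolP [&& adj u p, adj u q & adj u r]; last exact: (key _ _ _ u).
have -> : v = (p + y) + (q + y) + r by rewrite /v addrACA addvv addr0.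
have spy : sing (p + y) by apply: sing_add; rewrite // adjC.
have sqy : sing (q + y) by apply: sing_add; rewrite // adjC.
apply: (key _ _ _ u) => //.
- by rewrite adjDl !adjDr pq (adjC p) yp yq adjvv.
- by rewrite adjDl pr yr.
- by rewrite adjDl qr yr.
- by rewrite !adjDr up uq ur uy.
by rewrite !adjDr up uy.
Qed.

Lemma sing2_add v r : sing2 v -> sing r -> sing2 (v + r).
Proof.
case=> p [q [sp sq ->]] sr.
case pq: (adj p q); last by exists (p + q), r; split=> //; apply: sing_add.
case pr: (adj p r).
  case qr: (adj q r); first exact: sing2_add3.
  by exists p, (q + r); split; rewrite ?addrA //; apply: sing_add.
by exists (p + r), q; split; rewrite 1?addrAC //; apply: sing_add.
Qed.

Variables (I : finType) (e : I -> V) (iA iZ : I).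
Hypotheses (eA : e iA = a) (eZ : e iZ = z).
Hypothesis adj_e : forall i, i != iA -> i != iZ -> adj (e i) a && adj (e i) z.
Hypothesis De : forall i, D (e i).
Hypothesis Qe : forall i, Q (e i).
Hypothesis span_e : forall P : V -> Prop, P 0 -> (forall v i, P v -> P (v + e i)) ->
  forall v, P v.

(** This is the projection of [e i] to the orthogonal of [a] and [z]; adding [a] leaves [e i + z], a
    sum of two adjacent elements of [D]. *)
Lemma sing_basis i : i != iA -> i != iZ -> sing (e i + a + z).
Proof.
move=> nA nZ; have /andP[ia iz] := adj_e nA nZ.
split; rewrite ?QD ?adjDl ?Qe ?Qa ?Qz ?adjvv ?ia ?iz ?adj_az ?adj_za //.
rewrite addrAC addvK; apply: D_add => //.
Qed.

Let proj v := v + (if adj v z then a else 0) + (if adj v a then z else 0).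

Lemma sing2_proj v : sing2 (proj v).
Proof.
elim/span_e: v => [|v i IH].
  by rewrite /proj !adj0l !addr0; exists 0, 0; rewrite addr0; split=> //; apply: sing0.
have projD u w : proj (u + w) = proj u + proj w.
  rewrite /proj !adjDl.
  have ifD (b c : bool) x : (if b (+) c then x else 0) = (if b then x else 0) + (if c then x else 0) :> V.
    by case: b; case: c; rewrite /= ?addvv ?addr0 ?add0r.
  by rewrite !ifD (addrACA u w) (addrACA (u + _)) .
rewrite projD; apply: sing2_add => //.
have [->|nA] := eqVneq i iA.
  by rewrite eA /proj adj_az adjvv addvv addr0; apply: sing0.
have [->|nZ] := eqVneq i iZ.
  by rewrite eZ /proj adj_za adjvv addr0 addvv; apply: sing0.
by rewrite /proj; have /andP[-> ->] := adj_e nA nZ; apply: sing_basis.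
Qed.

(** Split [v] as [w + h] with [h] in the plane of [a] and [z] and [w] orthogonal to it. If [h] is
    nonzero, then [Q h = 1], so [w] is singular and [sing] applies; if [h = 0], then [v] is a sum of
    two elements of [sing], adjacent because [Q v = 1]. *)
Lemma generated_quad v : Q v -> D v.
Proof.
have dec u : perp_az u -> (Q u -> D u) /\ (Q u = false -> sing u).
  case/andP=> /negbTE ua /negbTE uz.
  have := sing2_proj u; rewrite /proj ua uz !addr0 => -[x [y [sx sy ->]]].
  case: (sx) (sy) => _ _ Qx _ [_ _ Qy _].
  by rewrite QD Qx Qy /=; split; [apply: sing_adj | apply: sing_add].
case va: (adj v a); case vz: (adj v z) => Qv.
- have /dec[_] : perp_az (v + (a + z)).
    by rewrite /perp_az !adjDl va vz !adjvv adj_az adj_za.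
  rewrite !QD !adjDr Qv Qa Qz va vz adj_az => /(_ erefl) /sing_add_az.
  by rewrite -addrA addvK.
- have /dec[_] : perp_az (v + z) by rewrite /perp_az !adjDl va vz adjvv adj_za.
  by rewrite QD Qv Qz vz => /(_ erefl) /sing_add_z; rewrite addvK.
- have /dec[_] : perp_az (v + a) by rewrite /perp_az !adjDl va vz adjvv adj_az.
  by rewrite QD Qv Qa va => /(_ erefl) [_ _ _]; rewrite addvK.
have /dec[Dv _] : perp_az v by rewrite /perp_az va vz.
exact: Dv.
Qed.

End Generation.

(** * Generation of the orthogonal group by reflections *)

Definition transv (t v : V) : V := if adj v t then v + t else v.

(** The four vectors are mutually orthogonal, so their terms [<w,t> t] simply add up, and modulo 2
    only the mixed term in [x] and [y] survives. The product is thus the analogue modulo 2 of E(x,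
    y). *)
Lemma transv4 x y z w : adj x y = false -> adj x z = false -> adj y z = false ->
  transv (x + (y + z)) (transv (y + z) (transv (x + z) (transv z w)))
  = w + ((if adj w x then y else 0) + (if adj w y then x else 0)).
Proof.
move=> xy xz yz.
have [yx zx zy] : [/\ adj y x = false, adj z x = false & adj z y = false].
  by rewrite (adjC y) !(adjC z).
have addvKl (t s : V) : t + (t + s) = s by rewrite addrA addvv add0r.
have simp := (adjDl, adjDr, xy, xz, yz, yx, zx, zy, adjvv).
rewrite {4}/transv; case wz: (adj w z);
rewrite {3}/transv !simp ?wz; case wx: (adj w x); rewrite /= ?simp ?wz ?wx /=;
rewrite {2}/transv ?simp ?wz ?wx /=; case wy: (adj w y); rewrite /= ?simp ?wz ?wx /=;
rewrite /transv ?simp ?wz ?wx ?wy /=;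
rewrite -?addrA ?addr0 ?add0r.
all: do !rewrite ?(addrC z x) ?(addrCA z x) ?(addrC y x) ?(addrCA y x)
  ?(addrC z y) ?(addrCA z y) ?addvv ?addvKl ?addr0 //.
Qed.

Hypothesis nondeg : forall v, v != 0 -> exists u, adj v u.
Hypothesis quad_perp2 : forall x y, exists z, [/\ Q z, adj x z = false & adj y z = false].

(* Cartan-Dieudonne: multiplying by a reflection in [S u + u] enlarges the fixed
   space.  When no [S u + u] is nonsingular, a product of four reflections does,
   and it exists because the ambient space is large enough. *)
Lemma orthogonal_transv_ind (P : (V -> V) -> Prop) :
  (forall S, S =1 id -> P S) ->
  (forall S t, Q t -> P (transv t \o S) -> P S) ->
  forall S : V -> V, {morph S : u v / u + v} -> (forall u, Q (S u) = Q u) -> P S.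
Proof.
move=> P1 PT S; have [k] := ubnP (#|V| - #|[set u | S u == u]|).
elim: k S => // k IH S lek SD SQ.
have [/forallP fixS|] := boolP [forall u, S u == u].
  by apply: P1 => u; apply/eqP.
rewrite negb_forall => /existsP[u Su].
have Sadj v w : adj (S v) (S w) = adj v w.
  have := SQ (v + w); rewrite SD !QD !SQ; case: (Q v); case: (Q w);
  by case: (adj (S v) (S w)); case: (adj v w).
have tD t : {morph transv t : v w / v + w}.
  move=> v w; rewrite /transv adjDl; case: (adj v t); case: (adj w t) => //=.
  - by rewrite addrACA addvv addr0.
  - by rewrite addrAC.
  - by rewrite addrA.
have tQ t v : Q t -> Q (transv t v) = Q v.
  rewrite /transv => Qt; case vt: (adj v t) => //.
  by rewrite QD Qt vt; case: (Q v).
have bigger S' w : S w != w -> (forall v, S v = v -> S' v = v) -> S' w = w ->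
    (#|V| - #|[set u | S' u == u]| < k)%N.
  move=> Sw fixS' S'w.
  have lt : (#|[set u | S u == u]| < #|[set u | S' u == u]|)%N.
    apply: proper_card; apply/properP; split.
      by apply/subsetP=> v; rewrite !inE => /eqP/fixS'/eqP.
    by exists w; rewrite !inE // S'w.
  have le : (#|[set u | S' u == u]| <= #|V|)%N by apply: max_card.
  by move: lt le lek; lia.
(* Vectors fixed by [S] are orthogonal to every displacement [S w + w], hence stay fixed after the
   reflections below. *)
have fixP w v : S v = v -> adj v (S w + w) = false.
  by move=> Sv; rewrite adjDr -{1}Sv Sadj addbb.
have [|] := boolP [exists w, adj (S w) w].
  case/existsP=> w Sww; apply: (PT S (S w + w)); first by rewrite QD SQ addbb Sww.
  apply: IH => [|v v'|v]; last 2 first.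
  - by rewrite /= SD tD.
  - by rewrite /= tQ // QD SQ addbb Sww.
  apply: (@bigger _ w); first by apply: contraTneq Sww => ->; rewrite adjvv.
    by move=> v Sv /=; rewrite Sv /transv fixP.
  by rewrite /= /transv adjDr adjvv Sww addrA addvv add0r.
rewrite negb_exists => /forallP Sww.
have Sw w : adj (S w) w = false by apply: negbTE.
set x := S u + u.
(* With this [v], the vector [S u] meets [y] but not [x], so the product of four reflections sends
   [S u] to [S u + x = u]. *)
have [v xv] : exists v, adj x v by apply: nondeg; rewrite addv_eq0.
set y := S v + v.
have [z [Qz xz yz]] := quad_perp2 x y.
have Qx : Q x = false by rewrite QD SQ addbb Sw.
have Qy : Q y = false by rewrite QD SQ addbb Sw.
have uv : adj u (S v) = adj (S u) v.
  have := Sw (u + v); rewrite SD !adjDl !adjDr !Sw /= addbF (adjC (S v)).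
  by case: (adj _ _); case: (adj _ _).
have xy : adj x y = false.
  by rewrite !adjDl !adjDr Sadj uv; case: (adj u v); case: (adj _ v).
have Sx : adj (S u) x = false by rewrite adjDr adjvv Sw.
have Sy : adj (S u) y by rewrite adjDr Sadj addbC -adjDl.
have [zx zy] : adj z x = false /\ adj z y = false by rewrite -!(adjC _ z).
have Q1 : Q (x + z) by rewrite QD Qx Qz xz.
have Q2 : Q (y + z) by rewrite QD Qy Qz yz.
have Q3 : Q (x + (y + z)) by rewrite QD Qx Q2 adjDr xy xz.
apply: (PT _ _ Qz); apply: (PT _ _ Q1); apply: (PT _ _ Q2); apply: (PT _ _ Q3).
apply: IH => [|w w'|w]; last 2 first.
- by rewrite /= SD !tD.
- by rewrite /= !tQ.
apply: (@bigger _ u) => // [w Sww'|] /=; rewrite transv4 //.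
  by rewrite Sww' (fixP u) // (fixP v) // !addr0.
by rewrite Sx Sy add0r addrA addvv add0r.
Qed.

End CharTwo.

(** * Transvections of a unimodular alternating form over the integers *)

Section EvenEuclid.
Local Open Scope ring_scope.

(** Even quotients preserve parities, so [x] and [y] never agree in absolute value. Adding or
    subtracting twice the smaller one therefore strictly shrinks the larger one, and the descent
    stops only at [y = 0]. *)
Lemma even_euclid (P : int -> int -> Prop) :
  (forall x y k, P (x + 2 * k * y) y -> P x y) ->
  (forall x y k, P x (y + 2 * k * x) -> P x y) ->
  (forall x, ~~ (2 %| x)%Z -> P x 0) ->
  forall x y, ~~ (2 %| x)%Z -> (2 %| y)%Z -> P x y.
Proof.
move=> Px Py P0 x y; have [N] := ubnP (`|x| + `|y|)%N.
elim: N x y => // N IH x y leN xodd yeven.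
have [->|yn0] := eqVneq y 0; first exact: P0.
have red (s t : int) : s != 0 -> (absz s < absz t)%N -> exists k, (absz (t + 2 * k * s)%R < absz t)%N.
  move=> s0 lt; case: (leP 0 s) => hs; case: (leP 0 t) => ht;
    by [exists 1; lia | exists (-1); lia].
have [lt|lt|e] := ltngtP (absz x) (absz y).
- have [|k lk] := red x y _ lt; first by lia.
  by apply: (Py _ _ k); apply: IH => //; lia.
- have [k lk] := red y x yn0 lt.
  by apply: (Px _ _ k); apply: IH => //; lia.
lia.
Qed.
End EvenEuclid.

(** * Integral transvections and planar maps *)

Section Form.
Local Open Scope ring_scope.
Variables (n : nat) (Om : 'M[int]_n).
Implicit Types (u v w x y : 'rV[int]_n) (S M : 'M[int]_n).

Definition bform u v : int := (u *m Om *m v^T) 0 0.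

Lemma dotDl u v w : bform (u + v) w = bform u w + bform v w.
Proof. by rewrite /bform !mulmxDl mxE. Qed.
Lemma dotDr u v w : bform w (u + v) = bform w u + bform w v.
Proof. by rewrite /bform linearD /= mulmxDr mxE. Qed.
Lemma dotZl k u v : bform (k *: u) v = k * bform u v.
Proof. by rewrite /bform -!scalemxAl mxE. Qed.
Lemma dotZr k u v : bform u (k *: v) = k * bform u v.
Proof. by rewrite /bform linearZ /= -scalemxAr mxE. Qed.
Lemma dotNl u v : bform (- u) v = - bform u v.
Proof. by rewrite -scaleN1r dotZl mulN1r. Qed.
Lemma dotNr u v : bform u (- v) = - bform u v.
Proof. by rewrite -scaleN1r dotZr mulN1r. Qed.
Lemma dot0l u : bform 0 u = 0.
Proof. by rewrite -(scale0r 0) dotZl mul0r. Qed.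
Lemma dot0r u : bform u 0 = 0.
Proof. by rewrite -(scale0r 0) dotZr mul0r. Qed.

Definition dotE := (dotDl, dotDr, dotZl, dotZr, dotNl, dotNr, dot0l, dot0r).

Definition transv_mx (k : int) v : 'M[int]_n := 1%:M + k *: (Om *m v^T *m v).

(* For orthogonal [x] and [y] these form an abelian group containing the
   transvections along every vector of the plane they span. *)
Definition planar_mx (p q r : int) x y : 'M[int]_n :=
  1%:M + p *: (Om *m x^T *m x) + q *: (Om *m x^T *m y + Om *m y^T *m x)
  + r *: (Om *m y^T *m y).

Lemma mulmx_rank1 u x y : u *m (Om *m x^T *m y) = bform u x *: y.
Proof. by rewrite !mulmxA [u *m _ *m x^T]mx11_scalar mul_scalar_mx. Qed.

Lemma mulmx_tv u k v : u *m transv_mx k v = u + (k * bform u v) *: v.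
Proof. by rewrite mulmxDr mulmx1 -scalemxAr mulmx_rank1 scalerA. Qed.

Lemma mulmx_planar u p q r x y : u *m planar_mx p q r x y =
  u + (p * bform u x + q * bform u y) *: x + (q * bform u x + r * bform u y) *: y.
Proof.
rewrite !mulmxDr mulmx1 -!scalemxAr mulmxDr !mulmx_rank1 scalerDr !scalerA.
by apply/rowP => i; rewrite !mxE; ring.
Qed.

Lemma mx_act_inj M M' : (forall u, u *m M = u *m M') -> M = M'.
Proof. by move=> e; apply/row_matrixP => i; rewrite !rowE e. Qed.

Hypothesis OmT : Om^T = - Om.
Hypothesis OmU : Om \in unitmx.

Lemma dotC u v : bform v u = - bform u v.
Proof.
have -> : bform v u = (u *m Om^T *m v^T) 0 0.
  by rewrite /bform -[v *m _ *m _]trmxK mxE !trmx_mul trmxK mulmxA.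
by rewrite OmT mulmxN mulNmx mxE.
Qed.

Lemma dotvv v : bform v v = 0.
Proof. by have := dotC v v; clear OmU; lia. Qed.

Lemma tv_planar k i j x y : bform x y = 0 ->
  transv_mx k (i *: x + j *: y) = planar_mx (k * i ^+ 2) (k * i * j) (k * j ^+ 2) x y.
Proof.
move=> xy; apply: mx_act_inj => u; rewrite mulmx_tv mulmx_planar !dotE.
by apply/rowP => l; rewrite !mxE; ring.
Qed.

Lemma tv_planarl k x y : transv_mx k x = planar_mx k 0 0 x y.
Proof.
apply: mx_act_inj => u; rewrite mulmx_tv mulmx_planar.
by apply/rowP => l; rewrite !mxE; ring.
Qed.

Lemma tv_planarr k x y : transv_mx k y = planar_mx 0 0 k x y.
Proof.
apply: mx_act_inj => u; rewrite mulmx_tv mulmx_planar.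
by apply/rowP => l; rewrite !mxE; ring.
Qed.

Lemma tv_planarD k x y : bform x y = 0 -> transv_mx k (x + y) = planar_mx k k k x y.
Proof.
move=> xy; apply: mx_act_inj => u; rewrite mulmx_tv mulmx_planar !dotE.
by apply/rowP => l; rewrite !mxE; ring.
Qed.

Lemma eq_planar p q r p' q' r' x y : p = p' -> q = q' -> r = r' ->
  planar_mx p q r x y = planar_mx p' q' r' x y.
Proof. by move=> -> -> ->. Qed.

Lemma planarM p q r p' q' r' x y : bform x y = 0 ->
  planar_mx p q r x y *m planar_mx p' q' r' x y = planar_mx (p + p') (q + q') (r + r') x y.
Proof.
move=> xy; have yx : bform y x = 0 by rewrite dotC xy.
apply: mx_act_inj => u; rewrite mulmxA !mulmx_planar !dotE !dotvv xy yx.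
by apply/rowP => l; rewrite !mxE; ring.
Qed.

Lemma tvM k l v : transv_mx k v *m transv_mx l v = transv_mx (k + l) v.
Proof.
apply: mx_act_inj => u; rewrite mulmxA !mulmx_tv !dotE dotvv.
by apply/rowP => i; rewrite !mxE; ring.
Qed.

Lemma tv0 v : transv_mx 0 v = 1%:M.
Proof. by rewrite /transv_mx scale0r addr0. Qed.

Lemma mulmx1_inv M M' : M *m M' = 1%:M -> invmx M = M'.
Proof.
by move=> e; have [uM _] := mulmx1_unit e; rewrite -[RHS](mulKmx uM) e mulmx1.
Qed.

Lemma tv_inv k v : invmx (transv_mx k v) = transv_mx (- k) v.
Proof. by apply: mulmx1_inv; rewrite tvM subrr tv0. Qed.

Lemma dot_nondeg v : (forall u, bform v u = 0) -> v = 0.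
Proof.
move=> v0; suff vOm : v *m Om = 0 by rewrite -(mulmxK OmU v) vOm mul0mx.
apply/rowP => i; have := v0 (delta_mx 0 i).
by rewrite /bform trmx_delta -colE mxE => ->; rewrite mxE.
Qed.

(** The Smith form of the one-row matrix [v] exhibits it as a multiple of a row of a unimodular
    matrix; a dual vector exists because [Om] is unimodular too. *)
Lemma dot_content v : v != 0 ->
  exists (c : int) x x', [/\ c != 0, v = c *: x & bform x x' = 1].
Proof.
move=> vn0; have i : 'I_n.
  by case: n v vn0 => [v|m v _]; [rewrite [v]thinmx0 eqxx | exact: ord0].
have n_gt0 : (0 < n)%N by apply: leq_ltn_trans (ltn_ord i).
pose i0 := Ordinal n_gt0.
have [L _ [R uR [d _ vE]]] := int_Smith_normal_form v.
have vE' : v = (L 0 0 * d`_0) *: row i0 R.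
  rewrite {1}vE {1}(mx11_scalar L) mul_scalar_mx -scalemxAl -scalerA; congr (_ *: _).
  rewrite rowE scalemxAl; congr (_ *m _); apply/rowP => j.
  by rewrite !mxE eqxx mulr_natr eq_sym.
exists (L 0 0 * d`_0), (row i0 R), (invmx Om *m invmx R *m delta_mx i0 0)^T.
split=> //; first by apply: contraNneq vn0 => c0; rewrite vE' c0 scale0r.
rewrite /bform trmxK -!mulmxA mulKVmx // rowE -mulmxA mulKVmx //.
by rewrite mul_delta_mx mxE !eqxx.
Qed.

Definition symplectic S : Prop := S *m Om *m S^T = Om.

Lemma symplectic_unit S : symplectic S -> S \in unitmx.
Proof.
move=> spS; have : S *m (Om *m S^T *m invmx Om) = 1%:M.
  by rewrite !mulmxA spS mulmxV.
by case/mulmx1_unit.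
Qed.

Lemma symplectic_dot S u v : symplectic S -> bform (u *m S) (v *m S) = bform u v.
Proof. by move=> spS; rewrite /bform trmx_mul !mulmxA -2!(mulmxA u) spS. Qed.

Lemma symplecticM S M : symplectic S -> symplectic M -> symplectic (S *m M).
Proof.
move=> spS spM; rewrite /symplectic trmx_mul !mulmxA.
by rewrite -[S *m M *m Om]mulmxA -(mulmxA S) spM.
Qed.

Lemma symplecticV S : symplectic S -> symplectic (invmx S).
Proof.
move=> spS; have uS := symplectic_unit spS.
rewrite /symplectic -{1}spS !mulmxA mulVmx // mul1mx -mulmxA -trmx_mul.
by rewrite mulVmx // trmx1 mulmx1.
Qed.

Lemma dot_symplecticV S u v : symplectic S -> bform (u *m invmx S) v = bform u (v *m S).
Proof.
move=> spS; rewrite -(symplectic_dot _ _ spS) mulmxKV //.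
exact: symplectic_unit.
Qed.

Lemma tv_conj S k v : symplectic S -> transv_mx k (v *m S) = invmx S *m (transv_mx k v *m S).
Proof.
move=> spS; apply: mx_act_inj => u; have uS := symplectic_unit spS.
by rewrite !mulmxA !mulmx_tv mulmxDl -scalemxAl mulmxKV // dot_symplecticV.
Qed.

Lemma planar_conj S p q r x y : symplectic S ->
  planar_mx p q r (x *m S) (y *m S) = invmx S *m (planar_mx p q r x y *m S).
Proof.
move=> spS; apply: mx_act_inj => u; have uS := symplectic_unit spS.
by rewrite !mulmxA !mulmx_planar !mulmxDl -!scalemxAl mulmxKV // !dot_symplecticV.
Qed.

End Form.

(** * Reduction of a primitive vector to a basis vector *)

Section Reduction.
Local Open Scope ring_scope.
Variables (n : nat) (Om : 'M[int]_n).
Hypothesis OmT : Om^T = - Om.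
Hypothesis OmU : Om \in unitmx.
Implicit Types (a b u v w x y t : 'rV[int]_n) (S M P : 'M[int]_n).
Local Notation dot := (bform Om).
Local Notation tv := (transv_mx Om).
Local Notation planar := (planar_mx Om).
Local Notation dotC := (dotC OmT).
Local Notation dotvv := (dotvv OmT).

(* The level 2 induction works in the image of [P], whose complement is already fixed. *)
Definition orthoproj P : Prop :=
  P *m P = P /\ forall u v, dot (u *m P) v = dot u (v *m P).

(** When [dot a b = 1], this is [P] minus the orthogonal projection onto the hyperbolic plane of [a]
    and [b]. *)
Definition split_plane P a b : 'M[int]_n :=
  P - Om *m b^T *m a + Om *m a^T *m b.

Lemma mulmx_split_plane P a b u :
  u *m split_plane P a b = u *m P - dot u b *: a + dot u a *: b.
Proof. by rewrite mulmxDr mulmxBr !mulmx_rank1. Qed.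

Lemma orthoproj1 : orthoproj 1%:M.
Proof. by split=> [|u v]; rewrite ?mulmx1. Qed.

Section Plane.
Variables (P : 'M[int]_n) (a b : 'rV[int]_n).
Hypotheses (projP : orthoproj P) (aP : a *m P = a) (bP : b *m P = b) (ab : dot a b = 1).
Let ba : dot b a = -1. Proof. by rewrite dotC ab. Qed.

Lemma orthoproj_split : orthoproj (split_plane P a b).
Proof.
have [PP Pdot] := projP; split=> [|u v].
  apply: mx_act_inj => u; rewrite mulmxA !mulmx_split_plane !mulmxDl mulNmx -!scalemxAl.
  rewrite aP bP -mulmxA PP !dotE !Pdot aP bP ab ba !dotvv.
  by apply/rowP => i; rewrite !mxE; ring.
by rewrite !mulmx_split_plane !dotE Pdot (dotC v a) (dotC v b); ring.
Qed.

Lemma split_plane_mem t : t *m split_plane P a b = t ->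
  [/\ t *m P = t, dot t a = 0 & dot t b = 0].
Proof.
have [PP Pdot] := projP.
have ta u : dot (u *m split_plane P a b) a = 0 /\ dot (u *m split_plane P a b) b = 0.
  by rewrite !mulmx_split_plane !dotE !Pdot aP bP ab ba !dotvv; split; ring.
move=> tP; have [t1 t2] := ta t; rewrite tP in t1 t2; split=> //.
by move: tP; rewrite mulmx_split_plane t1 t2 !scale0r subr0 addr0.
Qed.

End Plane.

Lemma orthoproj_content P v : orthoproj P -> v *m P = v -> v != 0 ->
  exists (c : int) x x', [/\ c != 0, v = c *: x, x *m P = x, x' *m P = x' & dot x x' = 1].
Proof.
move=> [PP Pdot] vP /(dot_content OmU)[c [x [x' [cn0 vE xx']]]].
have xP : x *m P = x.
  move: vP; rewrite vE -scalemxAl => e.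
  apply/rowP => i; move/rowP/(_ i): e; rewrite !mxE; exact: (mulfI cn0).
exists c, x, (x' *m P); split=> //; first by rewrite -mulmxA PP.
by rewrite -Pdot xP.
Qed.

Section Euclid.
Variables (H : 'M[int]_n -> Prop) (P : 'M[int]_n) (a b : 'rV[int]_n).
Hypotheses (H1 : H 1%:M) (HM : forall S M, H S -> H M -> H (S *m M)).
Hypothesis HSp : forall S, H S -> symplectic Om S.
Hypotheses (projP : orthoproj P) (aP : a *m P = a) (bP : b *m P = b) (ab : dot a b = 1).
Hypotheses (Ha : forall k : int, H (tv (2 * k) a)) (Hb : forall k : int, H (tv (2 * k) b)).
Hypothesis (Hab : H (tv 2 (a + b))).
Hypothesis HE : forall (k : int) t, t *m P = t -> dot t a = 0 -> dot t b = 0 ->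
  H (planar 0 (2 * k) 0 a t) /\ H (planar 0 (2 * k) 0 b t).
Let ba : dot b a = -1. Proof. by rewrite dotC ab. Qed.

Let reach v := exists S (x : int), H S /\ v *m S = x *: a.

Let reach_step v S : H S -> reach (v *m S) -> reach v.
Proof.
by move=> HS [M [x [HM' e]]]; exists (S *m M), x; split; [exact: HM | rewrite mulmxA].
Qed.

(** The planar map of [a] and [t'] adds [2 k c] to [x], and that of [b] and [t] adds [2 k x] to [c]:
    these are the moves of [even_euclid]. *)
Let reach_axis (x c : int) t t' : ~~ (2 %| x)%Z -> (2 %| c)%Z ->
  t *m P = t -> dot t a = 0 -> dot t b = 0 ->
  t' *m P = t' -> dot t' a = 0 -> dot t' b = 0 ->
  (c = 0 \/ dot t t' = 1) -> reach (x *: a + c *: t).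
Proof.
move=> xodd ceven tP ta tb t'P t'a t'b [->|tt'].
  by exists 1%:M, x; rewrite mulmx1 scale0r addr0.
move: x c xodd ceven; apply: even_euclid => [x c k h|x c k h|x _].
- apply: (@reach_step _ (planar 0 (2 * k) 0 a t')); first by case: (HE k t'P t'a t'b).
  move: h; rewrite mulmx_planar !dotE dotvv ta tt' (dotC t' a) t'a.
  congr reach; apply/rowP => i; rewrite !mxE; ring.
- apply: (@reach_step _ (planar 0 (2 * k) 0 b t)); first by case: (HE k tP ta tb).
  move: h; rewrite mulmx_planar !dotE dotvv ab tb (dotC t a) ta.
  congr reach; apply/rowP => i; rewrite !mxE; ring.
by exists 1%:M, x; rewrite mulmx1 scale0r addr0.
Qed.

(** Even powers of the transvections along [a] and [b] run Euclid's algorithm on [x] and [y] without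
    touching [c *: t]; once [y = 0], [reach_axis] finishes. *)
Lemma reach_plane (x y c : int) t t' : ~~ (2 %| x)%Z -> (2 %| y)%Z -> (2 %| c)%Z ->
  t *m P = t -> dot t a = 0 -> dot t b = 0 ->
  t' *m P = t' -> dot t' a = 0 -> dot t' b = 0 ->
  (c = 0 \/ dot t t' = 1) -> reach (x *: a + y *: b + c *: t).
Proof.
move=> xodd yeven ceven tP ta tb t'P t'a t'b ctt'.
move: x y xodd yeven; apply: even_euclid => [x y k h|x y k h|x xodd].
- apply: (@reach_step _ (tv (2 * - k) a)) => //.
  move: h; rewrite mulmx_tv !dotE dotvv ta ba.
  congr reach; apply/rowP => i; rewrite !mxE; ring.
- apply: (@reach_step _ (tv (2 * k) b)) => //.
  move: h; rewrite mulmx_tv !dotE dotvv tb ab.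
  congr reach; apply/rowP => i; rewrite !mxE; ring.
by rewrite scale0r addr0; apply: (@reach_axis _ _ _ t').
Qed.

(** Congruence to [a] modulo 2 gives [v] an odd coefficient on [a] and even ones elsewhere, so
    [reach_plane] brings it to some [x *: a]. Primitivity, witnessed by [v'], forces [x] to be 1 or
    -1. *)
Lemma reduce_to v v' q : v *m P = v -> v = a + 2 *: q -> dot v v' = 1 ->
  exists2 S, H S & v *m S = a.
Proof.
move=> vP vq vv'.
have [[PP Pdot] [QQ Qdot]] := (projP, orthoproj_split projP aP bP ab).
set w := v *m split_plane P a b.
have wQ : w *m split_plane P a b = w by rewrite -mulmxA QQ.
have vE : v = dot v b *: a + (- dot v a) *: b + w.
  rewrite /w mulmx_split_plane vP.
  by apply/rowP => i; rewrite !mxE; ring.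
have [c [t [t' [wE [tP ta tb] [t'P t'a t'b] ctt']]]] : exists c t t',
  [/\ w = c *: t, [/\ t *m P = t, dot t a = 0 & dot t b = 0],
    [/\ t' *m P = t', dot t' a = 0 & dot t' b = 0] & c = 0 \/ dot t t' = 1].
  have [w0|wn0] := eqVneq w 0.
    exists 0, 0, 0; rewrite w0 scale0r !mul0mx !dot0l; split=> //; by left.
  have [c [t [t' [_ wE tQ t'Q tt']]]] := orthoproj_content (orthoproj_split projP aP bP ab) wQ wn0.
  exists c, t, t'; split=> //; [exact: split_plane_mem | exact: split_plane_mem | by right].
have [S [x [HS e]]] : reach v.
  rewrite vE wE; apply: (@reach_plane _ _ _ t t') => //.
  - by rewrite vq dotDl ab dotZl; lia.
  - by rewrite vq dotDl dotvv dotZl; lia.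
  case: ctt' => [->//|tt']; have -> : c = dot v t'.
    by rewrite vE wE !dotE tt' (dotC t') t'a (dotC t') t'b; ring.
  by rewrite vq dotDl (dotC t') t'a dotZl; lia.
have x1 : x * dot a (v' *m S) = 1.
  by rewrite -dotZl -e symplectic_dot //; apply: HSp.
have {x1} [x1|x1] : x = 1 \/ x = -1 
  by move/(congr1 absz): x1 => /eqP; rewrite abszM muln_eq1; lia.
  by exists S => //; rewrite e x1 scale1r.
(* These three factors send [- a] to [- 3 a - 2 b], then to [a - 2 b], then to [a]. *)
exists (S *m (tv 2 (a + b) *m (tv (2 * 1) a *m tv (2 * 1) b))); first by do !apply: HM.
rewrite mulmxA e x1 !mulmxA !mulmx_tv !dotE !dotvv ab ba.
by apply/rowP => i; rewrite !mxE; ring.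
Qed.

End Euclid.
End Reduction.

(** * Reduction of integer matrices modulo 2 *)

Section ModTwo.
Local Open Scope ring_scope.

Definition rmod2 m n (M : 'M[int]_(m, n)) : 'M['F_2]_(m, n) := map_mx intr M.

Lemma mod2E n (S : 'M[int]_n) : mod2 S = rmod2 S. Proof. by []. Qed.

Lemma intr_F2 (z : int) : (z%:~R == 0 :> 'F_2) = (2 %| z)%Z.
Proof. by rewrite -(dvdz_pcharf (pchar_Fp (isT : prime 2))). Qed.

Lemma F2_cases (x : 'F_2) : x = 0 \/ x = 1.
Proof. by case: x => [[|[|//]] ?]; [left | right]; apply: val_inj. Qed.

Lemma rmod2_surj m n (M : 'M['F_2]_(m, n)) : exists N, M = rmod2 N.
Proof.
exists (\matrix_(i, j) (M i j != 0)%:Z); apply/matrixP => i j; rewrite !mxE.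
by case: (F2_cases (M i j)) => ->.
Qed.

Lemma rmod2_even m n (M : 'M[int]_(m, n)) : rmod2 (2 *: M) = 0.
Proof. by apply/matrixP => i j; rewrite !mxE; apply/eqP; rewrite intr_F2 dvdz_mulr. Qed.

Lemma rmod2_eq m n (M N : 'M[int]_(m, n)) : rmod2 M = rmod2 N -> exists Q, M = N + 2 *: Q.
Proof.
move=> e; exists (\matrix_(i, j) ((M i j - N i j) %/ 2)%Z).
apply/matrixP => i j; rewrite !mxE.
move/matrixP/(_ i j)/eqP: e; rewrite !mxE -subr_eq0 -rmorphB intr_F2 => /divzK.
by rewrite mulrC => ->; rewrite addrC subrK.
Qed.

Lemma rmod2M m n k (M : 'M[int]_(m, n)) (N : 'M_(n, k)) :
  rmod2 (M *m N) = rmod2 M *m rmod2 N.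
Proof. exact: map_mxM. Qed.

Lemma rmod2D m n (M N : 'M[int]_(m, n)) : rmod2 (M + N) = rmod2 M + rmod2 N.
Proof. exact: map_mxD. Qed.

Lemma rmod2_1 n : rmod2 (1%:M : 'M[int]_n) = 1%:M.
Proof. exact: map_mx1. Qed.

Lemma rmod2_delta m n i j : rmod2 (delta_mx i j : 'M[int]_(m, n)) = delta_mx i j.
Proof. exact: map_delta_mx. Qed.

Lemma rmod2_tr m n (M : 'M[int]_(m, n)) : (rmod2 M)^T = rmod2 M^T.
Proof. by apply/matrixP => i j; rewrite !mxE. Qed.

Lemma row_span_ind (R : pzRingType) n (P : 'rV[R]_n -> Prop) :
  P 0 -> (forall v i k, P v -> P (v + k *: delta_mx 0 i)) -> forall v, P v.
Proof.
move=> P0 PD v; rewrite [v]row_sum_delta.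
have: forall s u, P u -> P (u + \sum_(j <- s) v 0 j *: delta_mx 0 j).
  elim=> [|i s IH] u Pu; first by rewrite big_nil addr0.
  by rewrite big_cons addrA; apply/IH/PD.
by move/(_ (index_enum 'I_n) 0 P0); rewrite add0r.
Qed.

End ModTwo.

(** * The group containing the transvections along a basis *)

Section Arithmetic.
Local Open Scope ring_scope.
Variables (n : nat) (Om : 'M[int]_n).
Hypothesis OmT : Om^T = - Om.
Hypothesis OmU : Om \in unitmx.
Implicit Types (a b u v w t : 'rV[int]_n) (S M P : 'M[int]_n).
Local Notation dot := (bform Om).
Local Notation tv := (transv_mx Om).
Local Notation planar := (planar_mx Om).
Local Notation dotC := (dotC OmT).
Local Notation dotvv := (dotvv OmT).
Local Notation e i := (delta_mx 0 i).

Variable G : 'M[int]_n -> Prop.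
Hypotheses (G1 : G 1%:M) (GM : forall S M, G S -> G M -> G (S *m M)).
Hypotheses (GV : forall S, G S -> G (invmx S)) (GSp : forall S, G S -> symplectic Om S).

Definition has_transv v := G (tv 1 v).

Lemma has_transv_pow k v : G (tv k v) -> forall m : int, G (tv (m * k) v).
Proof.
move=> Gk; have nat_case j : G (tv (j%:Z * k) v).
  elim: j => [|j IH]; first by rewrite mul0r tv0.
  by rewrite intS mulrDl mul1r -tvM //; apply: GM.
case=> [j|j]; first exact: nat_case.
by rewrite NegzE mulNr -tv_inv //; apply: GV.
Qed.

Lemma has_transv_all v : has_transv v -> forall m : int, G (tv m v).
Proof. by move=> Gv m; rewrite -[m]mulr1; apply: has_transv_pow. Qed.

Lemma has_transv_conj v S : G S -> has_transv v -> has_transv (v *m S).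
Proof.
move=> GS Gv; rewrite /has_transv tv_conj //; last exact: GSp.
by apply: GM; [apply: GV | apply: GM].
Qed.

Lemma has_transv_step v w k : has_transv v -> has_transv w ->
  has_transv (v + (k * dot v w) *: w).
Proof.
by move=> Gv Gw; rewrite -mulmx_tv; apply: has_transv_conj => //; apply: has_transv_all.
Qed.

(** Transvections along [y], [a] and [c] carry [c] to [c - 2 y], then to [a + c - 2 y], then to
    [a - 2 y]. In the power [- k] of the transvection along [a - 2 y], cancelling the squares of [a]
    and [y] leaves the mixed coefficient [2 k]. *)
Lemma planar_neighbor a y c : has_transv a -> has_transv y -> has_transv c ->
  dot a y = 0 -> dot c a = -1 -> dot c y = -1 ->
  forall k : int, G (planar 0 (2 * k) 0 a y).
Proof.
move=> Ga Gy Gc ay ca cy k.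
have ya : dot y a = 0 by rewrite dotC ay.
have [ac yc] : dot a c = 1 /\ dot y c = 1 by rewrite dotC ca dotC cy.
have Gay : has_transv (1 *: a + (-2) *: y).
  have := has_transv_step 1 (has_transv_step (-1) (has_transv_step 2 Gc Gy) Ga) Gc.
  rewrite !dotE ?dotvv ca cy ya ac yc; congr has_transv.
  by apply/rowP => i; rewrite !mxE; ring.
have := GM (has_transv_all Gay (- k)) (GM (has_transv_all Ga k) (has_transv_all Gy (4 * k))).
rewrite (tv_planarl Om k a y) (tv_planarr Om (4 * k) a y) (tv_planar _ _ _ ay).
by rewrite !(planarM OmT _ _ _ _ _ _ ay); congr G; apply: eq_planar; ring.
Qed.

Variables (A Z m1 m2 : 'I_n).
Hypotheses (AnZ : A != Z) (m12 : m1 != m2).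
Hypotheses (m1n : (m1 != A) && (m1 != Z)) (m2n : (m2 != A) && (m2 != Z)).
Hypotheses (OmA : forall i, i != A -> Om A i = 1) (OmZ : forall i, i != Z -> Om Z i = -1).
Hypothesis Om12 : Om m1 m2 = 0.
Hypothesis Ge : forall i, has_transv (e i).

Let a : 'rV[int]_n := e A.
Let b : 'rV[int]_n := e Z.

Lemma dot_delta i j : dot (e i) (e j) = Om i j.
Proof. by rewrite /bform trmx_delta -rowE -colE !mxE. Qed.

Let ab : dot a b = 1. Proof. by rewrite dot_delta OmA // eq_sym. Qed.
Let ba : dot b a = -1. Proof. by rewrite dotC ab. Qed.

(** The admissible [y] form a subgroup containing [a]: the maps for [u] and [v] compose to the one
    for [u + v] up to a power of the transvection along [a]. The projection [y + dot y a *: b] to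
    the orthogonal of [a] fixes [a], kills [b] and sends any other [e i] to [e i - b], for which [b]
    is a common neighbour. *)
Lemma planar_first y : dot y a = 0 -> forall k : int, G (planar 0 (2 * k) 0 a y).
Proof.
move=> ya; pose F y := dot y a = 0 /\ forall k : int, G (planar 0 (2 * k) 0 a y).
have FD u v : F u -> F v -> F (u + v).
  move=> [ua Fu] [va Fv]; split=> [|k]; first by rewrite dotDl ua va.
  have := GM (GM (Fu k) (Fv k)) (has_transv_all (Ge A) (- 4 * k ^+ 2 * dot u v)).
  congr G; apply: mx_act_inj => w.
  have [au av] : dot a u = 0 /\ dot a v = 0 by rewrite dotC ua dotC va.
  rewrite -/a !mulmxA mulmx_tv !mulmx_planar !dotE ua va dotvv ?au ?av.
  by apply/rowP => i; rewrite !mxE; ring.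
have FZ u m : F u -> F (m *: u).
  move=> [ua Fu]; split=> [|k]; first by rewrite dotZl ua mulr0.
  have := Fu (k * m); congr G; apply: mx_act_inj => w.
  by rewrite !mulmx_planar !dotE; apply/rowP => i; rewrite !mxE; ring.
have Fa : F a.
  split=> [|l]; first exact: dotvv.
  have := has_transv_all (Ge A) (4 * l); congr G; apply: mx_act_inj => w.
  by rewrite mulmx_planar mulmx_tv; apply/rowP => j; rewrite !mxE; ring.
have F0 : F 0 by have := FZ a 0 Fa; rewrite scale0r.
suff [_] : F (y + dot y a *: b) by rewrite ya scale0r addr0.
elim/row_span_ind: y {ya} => [|y i k IH].
  by rewrite dot0l add0r scale0r.
rewrite dotDl dotZl scalerDl addrACA -scalerA -scalerDr; apply: FD => //; apply: FZ.
have [->|iA] := eqVneq i A.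
  by rewrite dotvv scale0r addr0.
have iA1 : dot (e i) a = -1 by rewrite dotC dot_delta OmA.
have [iZ|iZ] := eqVneq i Z.
  by rewrite iZ ba scaleN1r subrr.
have iZ1 : dot (e i) b = 1 by rewrite dotC dot_delta OmZ.
rewrite iA1 scaleN1r; split=> [|l]; first by rewrite !dotE iA1 ba.
apply: (@planar_neighbor _ _ b (Ge A) _ (Ge Z)).
- have := has_transv_step (-1) (Ge i) (Ge Z).
  by rewrite -/b iZ1 mulr1 scaleN1r.
- by rewrite !dotE ab (dotC (e i)) iA1.
- exact: ba.
by rewrite !dotE dotvv (dotC (e i)) iZ1.
Qed.

Lemma planar_orbit S y : G S -> dot y (a *m S) = 0 ->
  forall k : int, G (planar 0 (2 * k) 0 (a *m S) y).
Proof.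
move=> GS ya k; have spS := GSp GS.
rewrite -[y](mulmxKV (symplectic_unit OmU spS)) planar_conj //.
by apply: GM; [exact: GV | apply: GM => //; apply: planar_first; rewrite dot_symplecticV].
Qed.

(* The braid relation moves [a] to any other basis vector. *)
Lemma basis_orbit i : exists2 S, G S & a *m S = e i.
Proof.
have [->|iA] := eqVneq i A; first by exists 1%:M; rewrite ?mulmx1.
exists (tv 1 (e i) *m tv 1 a); first by apply: GM; apply: Ge.
have ai : dot a (e i) = 1 by rewrite dot_delta OmA.
rewrite mulmxA !mulmx_tv !dotE ai (dotC a (e i)) ?dotvv ai.
by apply/rowP => j; rewrite !mxE; ring.
Qed.

Lemma orbit_of_congr v v' q : v = a + 2 *: q -> dot v v' = 1 -> exists2 S, G S & v *m S = a.
Proof.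
move=> vq vv'.
apply: (reduce_to OmT OmU G1 GM GSp (orthoproj1 _) (mulmx1 a) (mulmx1 b) ab _ _ _ _ (mulmx1 v) vq vv').
- by move=> k; apply/has_transv_all/Ge.
- by move=> k; apply/has_transv_all/Ge.
- apply: has_transv_all; have := has_transv_step 1 (Ge A) (Ge Z).
  by rewrite -/a -/b ab mulr1 scale1r.
move=> k t _ ta tb; split; first exact: planar_first.
have [S GS aS] := basis_orbit Z.
by rewrite /b -aS; apply: planar_orbit; rewrite // aS.
Qed.

(** * The image of the group modulo 2 *)

Definition adj2 (x y : 'rV['F_2]_n) : bool := (x *m rmod2 Om *m y^T) 0 0 != 0.

Lemma adj2_rmod u v : adj2 (rmod2 u) (rmod2 v) = ~~ (2 %| dot u v)%Z.
Proof.
by rewrite /adj2 -intr_F2 rmod2_tr -!rmod2M mxE.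
Qed.

Lemma adj2_Dl x y z : adj2 (x + y) z = adj2 x z (+) adj2 y z.
Proof.
have [[u ->] [v ->] [w ->]] : [/\ exists u, x = rmod2 u, exists v, y = rmod2 v & exists w, z = rmod2 w].
  by split; apply: rmod2_surj.
rewrite -rmod2D !adj2_rmod dotDl; clear; lia.
Qed.

Lemma adj2_C x y : adj2 x y = adj2 y x.
Proof.
have [[u ->] [v ->]] : (exists u, x = rmod2 u) /\ (exists v, y = rmod2 v).
  by split; apply: rmod2_surj.
by rewrite !adj2_rmod dotC; clear; lia.
Qed.

Lemma adj2_vv x : adj2 x x = false.
Proof. by have [u ->] := rmod2_surj x; rewrite adj2_rmod dotvv. Qed.

Lemma F2_addvv (x : 'rV['F_2]_n) : x + x = 0.
Proof.
apply/rowP => i; rewrite !mxE.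
by have [->|->] := F2_cases (x 0 i); rewrite ?addr0 //; apply: val_inj.
Qed.

Lemma rmod2_Om_unit : rmod2 Om \in unitmx.
Proof.
have e1 : rmod2 Om *m rmod2 (invmx Om) = 1%:M by rewrite -rmod2M mulmxV // rmod2_1.
exact: (mulmx1_unit e1).1.
Qed.

Lemma adj2_nondeg x : x != 0 -> exists i, adj2 x (e i).
Proof.
move=> xn0; apply/existsP; apply: contraNT xn0; rewrite negb_exists => /forallP x0.
have: x *m rmod2 Om = 0.
  apply/rowP => i; have := x0 i; rewrite /adj2 negbK trmx_delta -colE mxE => /eqP ->.
  by rewrite mxE.
by move=> e0; rewrite -(mulmxK rmod2_Om_unit x) e0 mul0mx.
Qed.

Lemma transv_rmod v x : transv adj2 (rmod2 v) x = x *m rmod2 (tv 1 v).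
Proof.
have [u ->] := rmod2_surj x; rewrite -rmod2M mulmx_tv mul1r /transv adj2_rmod.
case: (boolP (2 %| _)%Z) => [/dvdzP[k ->]|] /=.
  by rewrite rmod2D (mulrC k) -scalerA rmod2_even addr0.
move=> odd_uv; rewrite -rmod2D; apply/rowP => i; rewrite !mxE !rmorphD rmorphM /=.
case: (F2_cases (dot u v)%:~R) => [/eqP|->]; last by rewrite mul1r.
by rewrite intr_F2 (negbTE odd_uv).
Qed.

Variable Q : 'rV['F_2]_n -> bool.
Hypothesis QD : forall x y, Q (x + y) = Q x (+) Q y (+) adj2 x y.
Hypothesis Qe : forall i, Q (e i).
Hypothesis n_gt4 : (4 < n)%N.

Lemma adj2_delta i j : adj2 (e i) (e j) = ~~ (2 %| Om i j)%Z.
Proof. by rewrite -!rmod2_delta adj2_rmod dot_delta. Qed.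

Let in_orbit x := exists2 S, G S & x = rmod2 (a *m S).

(** The orbit of [a] modulo 2 is stable under transvections along its own elements, hence closed
    under sums of adjacent vectors, and [generated_quad] applies. The orthogonal pair it needs comes
    from the letters [m1] and [m2], which do not cross. *)
Lemma quad_orbit x : Q x -> in_orbit x.
Proof.
have OmAZ : Om A Z = 1 by rewrite OmA // eq_sym.
have adjm i : i != A -> i != Z -> adj2 (e i) (e A) && adj2 (e i) (e Z).
  by move=> iA iZ; rewrite !(adj2_C (e i)) !adj2_delta OmA // OmZ.
have orbD x1 y1 : in_orbit x1 -> in_orbit y1 -> adj2 x1 y1 -> in_orbit (x1 + y1).
  move=> [S GS ->] [M GM' ->] xy; exists (S *m tv 1 (a *m M)).
    by apply: GM => //; apply: has_transv_conj => //; apply: Ge.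
  by rewrite mulmxA [RHS]rmod2M -transv_rmod /transv xy.
have orbe i : in_orbit (e i).
  by have [S GS aS] := basis_orbit i; exists S; rewrite // aS rmod2_delta.
have AZ2 : adj2 (e A) (e Z) by rewrite adj2_delta OmAZ.
have [m1A m1Z] := andP m1n; have [m2A m2Z] := andP m2n.
have sb i : i != A -> i != Z -> sing adj2 Q in_orbit (e A) (e Z) (e i + e A + e Z).
  move=> iA iZ; apply: (sing_basis F2_addvv adj2_Dl adj2_C adj2_vv QD orbD
    _ _ _ _ _ _ _ _ (e := fun i => e i)); by eauto.
have nz i : i != A -> i != Z -> (e i + e A + e Z : 'rV['F_2]_n) 0 i = 1.
  by move=> iA iZ; rewrite !mxE !eqxx /= (negbTE iA) (negbTE iZ) !addr0.
have nz0 i : i != A -> i != Z -> (e i + e A + e Z : 'rV['F_2]_n) != 0.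
  by move=> iA iZ; apply/eqP => /rowP/(_ i)/eqP; rewrite nz // mxE.
have adj0 : adj2 (e m1 + e A + e Z) (e m2 + e A + e Z) = false.
  have := (adjm _ m1A m1Z, adjm _ m2A m2Z, adj2_delta m1 m2).
  rewrite Om12 => -[[/andP[h1 h2] /andP[h3 h4]] h5].
  rewrite !adj2_Dl !(adjDr adj2_Dl adj2_C) !adj2_vv h5 h1 h2.
  by rewrite (adj2_C (e A) (e m2)) (adj2_C (e Z) (e m2)) (adj2_C (e Z) (e A)) h3 h4 AZ2.
apply: (generated_quad F2_addvv adj2_Dl adj2_C adj2_vv QD orbD (orbe A) (orbe Z) AZ2
  (Qe A) (Qe Z) _ (sb _ m1A m1Z) (sb _ m2A m2Z) adj0 (nz0 _ m1A m1Z) (nz0 _ m2A m2Z) _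
  (e := fun i => e i) erefl erefl adjm orbe Qe).
- move=> y /andP[yA yZ] /adj2_nondeg[i yi].
  have iA : i != A by apply: contraNneq yA => <-.
  have iZ : i != Z by apply: contraNneq yZ => <-.
  exists (e i + e A + e Z); first exact: sb.
  by rewrite !adj2_Dl !(adj2_C _ y) yi (negbTE yA) (negbTE yZ).
- by apply: contraNneq m12 => /addIr/addIr/rowP/(_ m1); rewrite !mxE !eqxx /=; case: eqP.
move=> P P0 PD; apply: row_span_ind => // v i k.
by have [->|->] := F2_cases k; rewrite ?scale0r ?addr0 ?scale1r //; apply: PD.
Qed.

Lemma has_transv_lift x : Q x -> exists v S, [/\ x = rmod2 v, G S, v = a *m S & has_transv v].
Proof.
move=> /quad_orbit[S GS xE]; exists (a *m S), S; split=> //.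
by apply: has_transv_conj => //; apply: Ge.
Qed.

(** Otherwise [Q] vanishes on the common orthogonal of [x] and [y]. That space has dimension at
    least [n - 2] and would be totally isotropic, which forces [n <= 4]. *)
Lemma quad_perp2 x y : exists z, [/\ Q z, adj2 x z = false & adj2 y z = false].
Proof.
have [/existsP[z /and3P[Qz /negbTE xz /negbTE yz]]|] :=
  boolP [exists z, [&& Q z, ~~ adj2 x z & ~~ adj2 y z]]; first by exists z.
rewrite negb_exists => /forallP none; exfalso.
have [K rK KO] : exists2 K : 'M['F_2]_n, (n - 2 <= \rank K)%N &
    K *m rmod2 Om *m row_mx x^T y^T = 0.
  exists (kermx (rmod2 Om *m row_mx x^T y^T)); last by rewrite -mulmxA mulmx_ker.
  by rewrite mxrank_ker leq_sub2l // rank_leq_col.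
have Kxy (u : 'rV_n) : adj2 x (u *m K) = false /\ adj2 y (u *m K) = false.
  have := congr1 (mulmx u) KO.
  rewrite mulmx0 !mulmxA mul_mx_row -[0]row_mx0 => /eq_row_mx[ux uy].
  by rewrite adj2_C (adj2_C y) /adj2 ux uy mxE eqxx.
have Q0 (u : 'rV_n) : Q (u *m K) = false.
  by have := none (u *m K); have [-> ->] := Kxy u; rewrite /= andbT => /negbTE.
have KK : K *m (rmod2 Om *m K^T) = 0.
  apply/matrixP => i j; rewrite [RHS]mxE.
  have := QD (delta_mx 0 i *m K) (delta_mx 0 j *m K).
  rewrite -mulmxDl !Q0 /= /adj2 => /esym/negbFE/eqP <-.
  have -> : (K *m (rmod2 Om *m K^T)) i j =
    ((e i : 'rV_n) *m (K *m (rmod2 Om *m K^T)) *m (e j : 'rV_n)^T) 0 0.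
    by rewrite trmx_delta -rowE -colE !mxE.
  by rewrite trmx_mul !mulmxA.
rewrite mulmxA in KK; have := mulmx0_rank_max KK.
rewrite mxrankMfree ?row_free_unit ?rmod2_Om_unit // mxrank_tr.
by move: rK n_gt4; clear; lia.
Qed.

Lemma orthogonal_lift (f : 'M['F_2]_n) :
  (forall x, Q (x *m f) = Q x) -> exists2 S, G S & f = rmod2 S.
Proof.
move=> fQ.
suff [S GS fS] : exists2 S, G S & forall x : 'rV_n, x *m f = x *m rmod2 S.
  by exists S => //; apply/row_matrixP => i; rewrite !rowE.
pose lifts (h : 'rV['F_2]_n -> 'rV['F_2]_n) :=
  exists2 S, G S & forall x, h x = x *m rmod2 S.
have nondeg (x : 'rV['F_2]_n) : x != 0 -> exists y, adj2 x y by move=> /adj2_nondeg[i xi]; exists (e i).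
apply: (orthogonal_transv_ind F2_addvv adj2_Dl adj2_C adj2_vv QD nondeg quad_perp2
  (P := lifts) _ _ (S := fun x => x *m f)) => //.
- by move=> h hid; exists 1%:M => // x; rewrite hid rmod2_1 mulmx1.
- move=> h x /has_transv_lift[v [_ [-> _ _ Gv]]] [S GS hS].
  (* A reflection is an involution, so applying it once more to the lifted composite recovers
     [h]. *)
  exists (S *m tv 1 v); first exact: GM.
  move=> y; rewrite rmod2M mulmxA -hS /= -transv_rmod /transv.
  case hx: (adj2 (h y) (rmod2 v)); last by rewrite hx.
  by rewrite adj2_Dl hx adj2_vv addvK //; apply: F2_addvv.
by move=> x y; rewrite mulmxDl.
Qed.

(** Some [S] in [G] carries [a] to [v] modulo 2; undoing it leaves a primitive vector congruent to
    [a], which [orbit_of_congr] handles. *)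
Lemma quad_orbit_int v v' : Q (rmod2 v) -> dot v v' = 1 -> exists2 S, G S & v = a *m S.
Proof.
move=> /quad_orbit[S GS vS] vv'; have uS := symplectic_unit OmU (GSp GS).
have [q vq] : exists q, v *m invmx S = a + 2 *: q.
  by apply: rmod2_eq; rewrite rmod2M vS -rmod2M mulmxK.
have [|M GM' aM] := @orbit_of_congr _ (v' *m invmx S) _ vq.
  by rewrite symplectic_dot //; apply: symplecticV => //; apply: GSp.
exists (invmx M *m S); first by apply: GM => //; apply: GV.
by rewrite -aM mulmxA mulmxK ?mulmxKV //; apply: (symplectic_unit OmU); apply: GSp.
Qed.

(** If [Q] vanishes at [v], write [v] as [x + (v - x)] with [x] primitive, orthogonal to [v] and
    [v'], and nonsingular modulo 2. Both summands are then in the orbit of [a], and the square along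
    [v] is the product of their squares and of a planar map. *)
Lemma square_transv_prim v v' : dot v v' = 1 -> G (tv 2 v).
Proof.
move=> vv'; have [Qv|Qv] := boolP (Q (rmod2 v)).
  have [S GS ->] := quad_orbit_int Qv vv'.
  by apply: has_transv_all; apply: has_transv_conj => //; apply: Ge.
have v'v : dot v' v = -1 by rewrite dotC vv'.
have [z [Qz vz v'z]] := quad_perp2 (rmod2 v) (rmod2 v').
have [u uE] := rmod2_surj z; rewrite {z}uE !adj2_rmod in Qz vz v'z.
(* The projection of [u] to the orthogonal of [v] and [v']; both coefficients are even, so the class
   modulo 2 does not change. *)
pose w := u - dot u v' *: v + dot u v *: v'.
have [wv wv'] : dot w v = 0 /\ dot w v' = 0.
  by rewrite /w !dotE !dotvv vv' v'v; split; ring.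
have wE : rmod2 w = rmod2 u.
  have /dvdzP[k uvE] : (2 %| dot u v)%Z by move: vz; rewrite dotC; clear; lia.
  have /dvdzP[l uv'E] : (2 %| dot u v')%Z by move: v'z; rewrite dotC; clear; lia.
  have -> : w = u + 2 *: (- l *: v + k *: v').
    by rewrite /w uvE uv'E; apply/rowP => i; rewrite !mxE; ring.
  by rewrite rmod2D rmod2_even addr0.
have wn0 : w != 0.
  apply: contraTneq Qz => w0; rewrite -wE w0.
  have -> : rmod2 (0 : 'rV[int]_n) = 0 by apply/rowP => i; rewrite !mxE.
  by rewrite (quad0 F2_addvv adj2_Dl QD).
have [c [x [x' [cn0 wx xx']]]] := dot_content OmU wn0.
have codd : ~~ (2 %| c)%Z.
  apply: contraTN Qz => /dvdzP[k cE]; rewrite -wE wx cE mulrC -scalerA rmod2_even.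
  by rewrite (quad0 F2_addvv adj2_Dl QD).
have Qx : Q (rmod2 x).
  have -> : rmod2 x = rmod2 w.
    have [k cE] : exists k, c = 1 + 2 * k by exists (c %/ 2)%Z; move: codd; clear; lia.
    by rewrite wx cE scalerDl scale1r -scalerA rmod2D rmod2_even addr0.
  by rewrite wE.
have [xv xv'] : dot x v = 0 /\ dot x v' = 0.
  move: wv wv'; rewrite wx !dotZl => /eqP + /eqP.
  by rewrite !mulf_eq0 (negbTE cn0) /= => /eqP -> /eqP ->.
have Qy : Q (rmod2 (v - x)).
  have -> : v - x = (v + x) + 2 *: (- x) by apply/rowP => i; rewrite !mxE; ring.
  rewrite rmod2D rmod2_even addr0 rmod2D QD (negbTE Qv) Qx adj2_rmod dotC xv.
  by rewrite oppr0.
have [S GS xE] := quad_orbit_int Qx xx'.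
have [|M GM' yE] := @quad_orbit_int _ v' Qy; first by rewrite !dotE vv' xv' subr0.
have yx : dot (v - x) x = 0 by rewrite !dotE dotvv (dotC x) xv oppr0 subr0.
have xy : dot x (v - x) = 0 by rewrite dotC yx oppr0.
have Gx : has_transv x by rewrite xE; apply: has_transv_conj => //; apply: Ge.
have Gy : has_transv (v - x) by rewrite yE; apply: has_transv_conj => //; apply: Ge.
have Gxy : G (planar 0 (2 * 1) 0 x (v - x)).
  by rewrite xE; apply: planar_orbit => //; rewrite -xE.
have := GM Gxy (GM (has_transv_all Gx 2) (has_transv_all Gy 2)).
rewrite (tv_planarl Om 2 x (v - x)) (tv_planarr Om 2 x (v - x)) !(planarM OmT _ _ _ _ _ _ xy).
have -> : tv 2 v = tv 2 (x + (v - x)) by rewrite addrC subrK.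
by rewrite tv_planarD.
Qed.

Lemma square_transv v k : G (tv (2 * k) v).
Proof.
have [->|vn0] := eqVneq v 0.
  by have := G1; congr G; apply: mx_act_inj => u; rewrite mulmx_tv mulmx1 scaler0 addr0.
have [c [x [x' [_ -> xx']]]] := dot_content OmU vn0.
have := has_transv_pow (square_transv_prim xx') (k * c ^+ 2); congr G.
by apply: mx_act_inj => u; rewrite !mulmx_tv !dotE scalerA; congr (_ + _ *: _); ring.
Qed.

Lemma even_planar x y k : dot x y = 0 -> G (planar 0 (2 * k) 0 x y).
Proof.
move=> xy; have := GM (square_transv (x + y) k) (GM (square_transv x (- k)) (square_transv y (- k))).
rewrite (tv_planarD _ xy) (tv_planarl Om _ x y) (tv_planarr Om _ x y).
by rewrite !(planarM OmT _ _ _ _ _ _ xy); congr G; apply: eq_planar; ring.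
Qed.

Lemma rmod2_even_tv k v : rmod2 (tv (2 * k) v) = 1%:M.
Proof. by rewrite /transv_mx -scalerA rmod2D rmod2_even addr0 rmod2_1. Qed.

Lemma rmod2_even_planar k x y : rmod2 (planar 0 (2 * k) 0 x y) = 1%:M.
Proof. by rewrite /planar_mx !scale0r !addr0 -scalerA rmod2D rmod2_even addr0 rmod2_1. Qed.

(** * Generation of the congruence subgroup of level 2 *)

Definition fixes P S : Prop :=
  [/\ symplectic Om S, rmod2 S = 1%:M & forall u, (u - u *m P) *m S = u - u *m P].

Lemma fixes1 P : fixes P 1%:M.
Proof. by split=> [||u]; rewrite ?rmod2_1 ?mulmx1 // /symplectic mul1mx trmx1 mulmx1. Qed.

Lemma fixesM P S M : fixes P S -> fixes P M -> fixes P (S *m M).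
Proof.
move=> [spS S2 SP] [spM M2 MP]; split; first exact: symplecticM.
  by rewrite rmod2M S2 M2 mulmx1.
by move=> u; rewrite mulmxA SP MP.
Qed.

Lemma orthoproj_compl P u w : orthoproj Om P -> w *m P = w -> dot (u - u *m P) w = 0.
Proof. by move=> [_ Pdot] wP; rewrite !dotE Pdot wP subrr. Qed.

Lemma fixes_tv P k v : orthoproj Om P -> v *m P = v -> fixes P (tv (2 * k) v).
Proof.
move=> projP vP; split; first exact/GSp/square_transv.
  exact: rmod2_even_tv.
by move=> u; rewrite mulmx_tv (orthoproj_compl _ projP vP) mulr0 scale0r addr0.
Qed.

Lemma fixes_planar P k x y : orthoproj Om P -> x *m P = x -> y *m P = y -> dot x y = 0 ->
  fixes P (planar 0 (2 * k) 0 x y).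
Proof.
move=> projP xP yP xy; split; first exact/GSp/even_planar.
  exact: rmod2_even_planar.
move=> u; rewrite mulmx_planar (orthoproj_compl _ projP xP) (orthoproj_compl _ projP yP).
by rewrite !mulr0 !addr0 !scale0r !addr0.
Qed.

(** The image of [P] is the orthogonal of the vectors [u - u *m P], which [S] fixes. *)
Lemma fixes_mem P S w : orthoproj Om P -> fixes P S -> w *m P = w -> (w *m S) *m P = w *m S.
Proof.
move=> projP [spS _ SP] wP; have [_ Pdot] := projP.
apply/eqP; rewrite eq_sym -subr_eq0; apply/eqP/(dot_nondeg OmU) => u.
rewrite dotDl dotNl Pdot -dotNr -dotDr -SP symplectic_dot // dotC.
by rewrite (orthoproj_compl _ projP wP) oppr0.
Qed.

Lemma fixes_even P S v : fixes P S -> exists q, v *m S = v + 2 *: q.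
Proof. by move=> [_ S2 _]; apply: rmod2_eq; rewrite rmod2M S2 mulmx1. Qed.

(** First [reduce_to] brings [u *m S] back to [u]. The image of [v] is then [v + 2 r] with [r]
    orthogonal to [u]; the planar map of [u] and [r] turns it into [v + 2 k u], where [k = dot v r],
    and a transvection along [u] restores [v]. Neither map moves [u]. *)
Lemma fixes_split P S u v : orthoproj Om P -> u *m P = u -> v *m P = v -> dot u v = 1 ->
  fixes P S -> exists2 M, G M & fixes (split_plane Om P u v) (S *m M).
Proof.
move=> projP uP vP uv fS; have [spS _ _] := fS.
have vu : dot v u = -1 by rewrite dotC uv.
pose H M := G M /\ fixes P M.
have Htv k w : w *m P = w -> H (tv (2 * k) w).
  by move=> wP; split; [exact: square_transv | exact: fixes_tv].
have Hpl k x y : x *m P = x -> y *m P = y -> dot x y = 0 -> H (planar 0 (2 * k) 0 x y).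
  by move=> xP yP xy; split; [exact: even_planar | exact: fixes_planar].
have HM M N : H M -> H N -> H (M *m N).
  by move=> [GM1 fM] [GN fN]; split; [exact: GM | exact: fixesM].
have [q uSq] := fixes_even u fS.
have [|||M [GM1 fM] uM] := reduce_to OmT OmU (H := H) _ HM (fun M h => GSp h.1) projP uP vP uv
    (fun k => Htv k u uP) (fun k => Htv k v vP) _ _ (fixes_mem projP fS uP) uSq
    (etrans (symplectic_dot u v spS) uv).
- by split; [exact: G1 | exact: fixes1].
- by have := Htv 1 (u + v); rewrite mulr1; apply; rewrite mulmxDl uP vP.
- by move=> k t tP tu tv0; split; apply: Hpl => //; rewrite dotC ?tu ?tv0 oppr0.
have fSM := fixesM fS fM; have [spSM _ _] := fSM.
have uSM : u *m (S *m M) = u by rewrite mulmxA.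
have [r vr] := fixes_even v fSM.
have vSMP := fixes_mem projP fSM vP.
have rP : r *m P = r.
  have := vSMP; rewrite vr mulmxDl vP -scalemxAl => /addrI rP.
  by apply/rowP => i; move/rowP/(_ i): rP; rewrite !mxE => /(mulfI (isT : 2 != 0 :> int)).
have ur : dot u r = 0.
  have := symplectic_dot u v spSM; rewrite uSM vr !dotE uv => /eqP.
  by rewrite -subr_eq0 addrAC subrr add0r mulf_eq0 /= => /eqP.
have ru : dot r u = 0 by rewrite dotC ur oppr0.
pose k : int := dot v r.
pose N := planar 0 (2 * 1) 0 u r *m tv (2 * k) u.
have [GN fN] : H N by apply: HM; [exact: Hpl | exact: Htv].
have uN : u *m N = u.
  rewrite /N mulmxA mulmx_tv mulmx_planar !dotE !dotvv ur ru.
  by apply/rowP => i; rewrite !mxE; ring.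
have vN : (v *m (S *m M)) *m N = v.
  rewrite /N vr mulmxA mulmx_tv mulmx_planar !dotE !dotvv vu ru ?ur -/k.
  by apply/rowP => i; rewrite !mxE; ring.
exists (M *m N); first exact: GM.
rewrite mulmxA; have [spF F2 FP] := fixesM fSM fN; split=> // w.
have -> : w - w *m split_plane Om P u v = w - w *m P + dot w v *: u - dot w u *: v.
  by rewrite mulmx_split_plane; apply/rowP => i; rewrite !mxE; ring.
have uF : u *m (S *m M *m N) = u by rewrite mulmxA uSM uN.
have vF : v *m (S *m M *m N) = v by rewrite mulmxA vN.
by rewrite 2!mulmxDl FP mulNmx -!scalemxAl uF vF.
Qed.

(** Here [k] bounds the number of basis vectors not yet killed by [P]. If [P] does not kill the next
    one, its image is a multiple of a primitive [u]; splitting off a hyperbolic plane through [u]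
    kills it. When all are killed, [P = 0] and [S] is the identity. *)
Lemma level2_fixes k P S : orthoproj Om P ->
  (forall j : 'I_n, (j < n - k)%N -> (e j : 'rV[int]_n) *m P = 0) -> fixes P S -> G S.
Proof.
elim: k P S => [|k IH] P S projP eP fS.
  have [_ _ SP] := fS; have := G1; congr G; apply/row_matrixP => i; rewrite !rowE.
  by have := SP (e i); rewrite eP ?subn0 ?subr0 // mulmx1 => ->.
have [nk|kn] := leqP n k; first by apply: (IH P) => // j; rewrite (eqP nk).
have lt : (n - k.+1 < n)%N by move: kn; clear; lia.
pose i := Ordinal lt.
have jP (j : 'I_n) : (j < n - k)%N -> (j < n - k.+1)%N \/ j = i.
  move=> jk; have [->|ne] := eqVneq j i; [by right | left].
  by move: ne jk kn; rewrite -val_eqE /=; clear; lia.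
have [ei0|ein0] := eqVneq ((e i : 'rV[int]_n) *m P) 0.
  by apply: (IH P) => // j /jP[/eP//|->].
have [PP _] := projP.
have eiP : (e i : 'rV[int]_n) *m P *m P = e i *m P by rewrite -mulmxA PP.
have [c [u [v [_ eE uP vP uv]]]] := orthoproj_content OmU projP eiP ein0.
have vu : dot v u = -1 by rewrite dotC uv.
have [M GM1 fSM] := fixes_split projP uP vP uv fS.
suff GSM : G (S *m M).
  by rewrite -(mulmxK (symplectic_unit OmU (GSp GM1)) S); apply: GM => //; apply: GV.
apply: (IH _ _ (orthoproj_split OmT projP uP vP uv)) => // j /jP jk.
have [_ Pdot] := projP.
have [ju jv] : dot (e j) u = dot (e j *m P) u /\ dot (e j) v = dot (e j *m P) v.
  by rewrite !Pdot uP vP.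
rewrite mulmx_split_plane ju jv; case: jk => [/eP -> | ->].
  by rewrite !dot0l !scale0r subr0 addr0.
by rewrite eE !dotZl dotvv uv mulr0 mulr1 scale0r subrr addr0.
Qed.

Theorem arithmetic_group S :
  symplectic Om S -> (forall x, Q (x *m rmod2 S) = Q x) -> G S.
Proof.
move=> spS /orthogonal_lift[M GM1 SM].
have uM := symplectic_unit OmU (GSp GM1).
suff GSM : G (S *m invmx M) by rewrite -(mulmxKV uM S); apply: GM.
apply: (@level2_fixes n 1%:M); first exact: orthoproj1.
  by move=> j; rewrite subnn.
split; first by apply: symplecticM => //; apply: symplecticV => //; apply: GSp.
  by rewrite rmod2M SM -rmod2M mulmxV // rmod2_1.
by move=> u; rewrite mulmx1 subrr mul0mx.
Qed.

End Arithmetic.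

(** * Rauzy induction *)

Section Rauzy.
Variable n : nat.
Implicit Types (p q r : iperm n) (a b i j l w : 'I_n).

Lemma pt_inj p a b : pt p a = pt p b -> a = b.
Proof. by move/val_inj/perm_inj. Qed.

Lemma pb_inj p a b : pb p a = pb p b -> a = b.
Proof. by move/val_inj/perm_inj. Qed.

Lemma pt_lt p a : pt p a < n. Proof. exact: ltn_ord. Qed.
Lemma pb_lt p a : pb p a < n. Proof. exact: ltn_ord. Qed.

(** In this form row [a] is a difference of indicators of two initial segments, which [initial_row]
    exploits. *)
Lemma OmegaE p a b : Omega p a b = ((pb p b < pb p a)%N%:Z - (pt p b < pt p a)%N%:Z)%R.
Proof.
rewrite mxE; have [->|ne] := eqVneq a b; first by rewrite !ltnn.
have nt : pt p a <> pt p b by move/pt_inj; apply/eqP.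
have nb : pb p a <> pb p b by move/pb_inj; apply/eqP.
move: nt nb; clear; move: (pt p a) (pt p b) (pb p a) (pb p b) => x y z t.
by case: (ltngtP x y) => //; case: (ltngtP z t) => //=; lia.
Qed.

Lemma Omega_skew p : (Omega p)^T%R = (- Omega p)%R.
Proof.
apply/matrixP => a b; rewrite mxE [RHS]mxE !OmegaE.
have [->|ne] := eqVneq a b; first by rewrite !ltnn.
have nt : pt p a <> pt p b by move/pt_inj; apply/eqP.
have nb : pb p a <> pb p b by move/pb_inj; apply/eqP.
move: nt nb; clear; move: (pt p a) (pt p b) (pb p a) (pb p b) => x y z t.
lia.
Qed.

Definition iswap p : iperm n := (p.2, p.1).

Lemma iswapK p : iswap (iswap p) = p. Proof. by case: p. Qed.

Lemma Omega_iswap p : Omega (iswap p) = (- Omega p)%R.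
Proof.
apply/matrixP => a b; rewrite [RHS]mxE !OmegaE /pt /pb /=.
by rewrite opprB.
Qed.

Lemma irreducible_iswap p : perm_irreducible (iswap p) = perm_irreducible p.
Proof. by apply: eq_forallb => j; rewrite /= eq_sym. Qed.

Lemma top_step_iswap p q w l : top_step (iswap p) (iswap q) w l = bot_step p q w l.
Proof. by rewrite /top_step /bot_step irreducible_iswap. Qed.

Lemma rauzy_arrow_iswap p q w l :
  rauzy_arrow (iswap p) (iswap q) w l = rauzy_arrow p q w l.
Proof. by rewrite /rauzy_arrow orbC -!top_step_iswap. Qed.

(** Exchanging the two rows turns bottom operations into top ones, so only the latter need a
    computation. *)
Lemma arrow_ind (R : iperm n -> iperm n -> 'I_n -> 'I_n -> Prop) :
  (forall p q w l, top_step p q w l -> R p q w l) ->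
  (forall p q w l, R (iswap p) (iswap q) w l -> R p q w l) ->
  forall p q w l, rauzy_arrow p q w l -> R p q w l.
Proof.
by move=> Rt Rs p q w l /orP[/Rt //|]; rewrite -top_step_iswap => /Rt/Rs.
Qed.

Lemma top_stepP p q w l : reflect
  [/\ perm_irreducible p, pt p w = n.-1, pb p l = n.-1, q.1 = p.1 &
      forall a, pb q a = rshift n (pb p w) (pb p a)] (top_step p q w l).
Proof.
apply: (iffP and5P) => -[ip /eqP pw /eqP pl /eqP q1].
  by move/forallP=> q2; split=> // a; apply/eqP.
by move=> q2; split=> //; apply/forallP=> a; apply/eqP.
Qed.

Lemma irreducible_last p w : 1 < n -> perm_irreducible p -> pt p w = n.-1 ->
  pb p w < n.-1.
Proof.
move=> n1 /forallP ip pw; have n0 : n.-1 < n by move: n1; clear; lia.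
have := ip (Ordinal n0); rewrite /= -subn1 subn_gt0 n1 /= subn1.
apply: contraNltn => lw; apply/eqP/setP => a; rewrite !inE.
have := pt_lt p a; have := pb_lt p a; have := pb_lt p w.
have [->|ne] := eqVneq a w; first by move: pw lw; clear; lia.
have nt : pt p a <> pt p w by move/pt_inj; apply/eqP.
have nb : pb p a <> pb p w by move/pb_inj; apply/eqP.
by move: nt nb pw lw; clear; lia.
Qed.

Lemma top_step_winner p q w l : 1 < n -> top_step p q w l -> w != l.
Proof.
move=> n1 /top_stepP[ip pw pl _ _]; apply: contraPneq (irreducible_last n1 ip pw) => ->.
by rewrite pl ltnn.
Qed.

(** A common initial block of [q] omits the winner, which is last on top. On the bottom it thus lies
    left of the winner, where the operation moves nothing, so it is already a common block of
    [p]. *)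
Lemma irreducible_top_step p q w l : 1 < n -> top_step p q w l -> perm_irreducible q.
Proof.
move=> n1 st; have /top_stepP[ip pw pl q1 q2] := st.
have lt := irreducible_last n1 ip pw.
apply/forallP => j; apply/implyP => j0; have := ip; move/forallP/(_ j); rewrite j0 /=.
apply: contraNneq => /setP ej; apply/eqP/setP => a.
have ptq x : pt q x = pt p x by rewrite /pt q1.
have := ej w; rewrite !inE ptq pw q2 /rshift leqnn => ew.
have := ej a; rewrite !inE ptq q2 /rshift => ->.
have := pb_lt p a; move: ew (ltn_ord j) lt; clear.
by case: ifP => h; [by [] | case: ifP => h2; lia].
Qed.

Local Open Scope ring_scope.

Lemma mul_Bmx w l (M : 'M[int]_n) i j :
  (Bmx w l *m M) i j = M i j + (i == l)%:R * M w j.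
Proof.
rewrite /Bmx mulmxDl mul1mx mxE; congr (_ + _).
rewrite mxE (bigD1 w) //= big1 => [|k kw]; last by rewrite mxE (negbTE kw) andbF mul0r.
by rewrite mxE eqxx andbT addr0.
Qed.

Lemma mul_BmxT w l (M : 'M[int]_n) i j :
  (M *m (Bmx w l)^T) i j = M i j + (j == l)%:R * M i w.
Proof. by rewrite -[M *m _]trmxK trmx_mul trmxK mxE mul_Bmx !mxE. Qed.

Lemma Bmx_unit w l : w != l -> Bmx w l \in unitmx.
Proof.
move=> wl; have e : Bmx w l *m (1%:M - delta_mx l w) = 1%:M.
  apply/matrixP => i j; rewrite mul_Bmx !mxE (negbTE wl) /=.
  by rewrite subr0 (eq_sym w j); case: (i == l) => /=; rewrite ?mul0r ?mul1r ?subr0 ?addr0 // subrK.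
exact: (mulmx1_unit e).1.
Qed.

Lemma top_step_Omega p q w l : (1 < n)%N -> top_step p q w l ->
  Bmx w l *m Omega p *m (Bmx w l)^T = Omega q.
Proof.
move=> n1 st; have /top_stepP[ip pw pl q1 q2] := st.
have lt := irreducible_last n1 ip pw.
have ptq x : pt q x = pt p x by rewrite /pt q1.
apply/matrixP => i j; rewrite mul_BmxT !mul_Bmx !OmegaE !ptq !q2 /rshift.
have pwx x : (pt p x == n.-1) = (x == w).
  by apply/eqP/eqP => [|->//]; rewrite -pw => /pt_inj.
have plx x : (pb p x == n.-1) = (x == l).
  by apply/eqP/eqP => [|->//]; rewrite -pl => /pb_inj.
have pkx x : (pb p x == pb p w) = (x == w) by apply/eqP/eqP => [/pb_inj|->].
rewrite !plx.
have := pwx i; have := pwx j; have := pkx i; have := pkx j; have := plx i; have := plx j.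
have := pt_lt p i; have := pt_lt p j; have := pb_lt p i; have := pb_lt p j.
have wl := top_step_winner n1 st.
have := wl; have := lt; have := pw; have := pl.
have [->|il] := eqVneq i l; have [->|jl] := eqVneq j l; rewrite ?ltnn /= ?mulr1n ?mul1r ?mul0r ?addr0.
all: move: (pb p w) (pb p i) (pb p l) (pb p j) (pt p w) (pt p i) (pt p l) (pt p j).
all: rewrite ?(eq_sym l w); move: (w == l) (i == w) (j == w); clear; intros; repeat case: ifP => ?; lia.
Qed.

Lemma Qform_D p (u v : 'rV_n) :
  Qform p (u + v) = Qform p u + Qform p v + (u *m mod2 (Omega p) *m v^T) 0 0.
Proof.
have cross : (u *m mod2 (Omega p) *m v^T) 0 0 =
    \sum_a \sum_b u 0 a * (Omega p a b)%:~R * v 0 b.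
  rewrite -mulmxA mxE; apply: eq_bigr => a _.
  rewrite mxE mulr_sumr; apply: eq_bigr => b _.
  by rewrite !mxE mulrA.
(* Modulo 2 the form is symmetric with zero diagonal, so the double sum folds onto the pairs ordered
   by the top row. *)
have {}cross : (u *m mod2 (Omega p) *m v^T) 0 0 =
    \sum_a \sum_(b | (pt p a < pt p b)%N)
      (u 0 a * (Omega p a b)%:~R * v 0 b + v 0 a * (Omega p a b)%:~R * u 0 b).
  rewrite cross.
  under [RHS]eq_bigr do rewrite big_split.
  rewrite big_split /= [X in _ = _ + X](exchange_big_dep predT) //= -big_split.
  apply: eq_bigr => a _; rewrite (bigID (fun b => (pt p a < pt p b)%N)) /=; congr (_ + _).
  rewrite big_mkcond [RHS]big_mkcond; apply: eq_bigr => b _.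
  have [->|ab] := eqVneq a b; first by rewrite ltnn !mxE !ltnn mulr0 mul0r.
  have nt : pt p a <> pt p b by move/pt_inj; apply/eqP.
  rewrite -leqNgt ltn_neqAle (introN eqP) /=; last by move/esym.
  case: ifP => // _; have -> : Omega p a b = - Omega p b a.
    by have /matrixP/(_ b a) := Omega_skew p; rewrite !mxE.
  have oppF (t : 'F_2) : - t = t by case: (F2_cases t) => ->; apply: val_inj.
  by rewrite rmorphN /= -[RHS]oppF; ring.
rewrite cross /Qform.
have -> : \sum_i (u + v) 0 i = \sum_i u 0 i + \sum_i v 0 i.
  by rewrite -big_split; apply: eq_bigr => i _; rewrite mxE.
have dbl (f g h : 'I_n -> 'I_n -> 'F_2) :
    \sum_a \sum_(b | (pt p a < pt p b)%N) (f a b + g a b + h a b) =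
    \sum_a \sum_(b | (pt p a < pt p b)%N) f a b + \sum_a \sum_(b | (pt p a < pt p b)%N) g a b
    + \sum_a \sum_(b | (pt p a < pt p b)%N) h a b.
  rewrite -!big_split; apply: eq_bigr => a _.
  by rewrite -!big_split.
rewrite addrACA [RHS]addrAC; congr (_ + _); rewrite -dbl.
by apply: eq_bigr => a _; apply: eq_bigr => b _; rewrite !mxE; ring.
Qed.

Lemma Qform0 p : Qform p 0 = 0.
Proof.
have := Qform_D p 0 0; rewrite !mul0mx mxE !addr0 -{1}[Qform p 0]addr0.
by move/addrI/esym.
Qed.

Lemma Qform_delta p i : Qform p (delta_mx 0 i) = 1.
Proof.
rewrite /Qform big1 => [|a _]; last first.
  rewrite big1 // => b lt; rewrite !mxE /=.
  have [ai|_] := eqVneq a i; last by rewrite !mul0r.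
  have [bi|_] := eqVneq b i; last by rewrite mulr0.
  by move: lt; rewrite ai bi ltnn.
by rewrite add0r (bigD1 i) //= big1 => [|a ai]; rewrite !mxE ?eqxx ?addr0 // (negbTE ai).
Qed.

(* A quadratic form is determined by its polarization and its values on a basis. *)
Lemma Qform_transport p q (M : 'M[int]_n) :
  M *m Omega p *m M^T = Omega q ->
  (forall i, Qform p (delta_mx 0 i *m mod2 M) = 1) ->
  forall u, Qform p (u *m mod2 M) = Qform q u.
Proof.
move=> MO Me; elim/row_span_ind => [|v i k IH].
  by rewrite mul0mx !(Qform0).
have [->|->] := F2_cases k; first by rewrite scale0r !addr0.
rewrite scale1r mulmxDl !Qform_D IH Me Qform_delta trmx_mul !mulmxA; congr (_ + _).
by rewrite !mod2E -MO !rmod2M -rmod2_tr !mulmxA.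
Qed.

(** For a closed walk this invariant is the inclusion of RV(pi) in the preimage of O(Q). *)
Definition rauzy_transport p q (M : 'M[int]_n) : Prop :=
  [/\ M \in unitmx, M *m Omega p *m M^T = Omega q &
      forall u, Qform p (u *m mod2 M) = Qform q u].

Lemma rauzy_transportM p q r M N :
  rauzy_transport p q M -> rauzy_transport q r N -> rauzy_transport p r (N *m M).
Proof.
move=> [uM Mpq Qpq] [uN Nqr Qqr]; split; first by rewrite unitmx_mul uN.
  by rewrite trmx_mul !mulmxA -(mulmxA N) -(mulmxA N) Mpq.
by move=> u; rewrite mod2E rmod2M mulmxA Qpq Qqr.
Qed.

Lemma rauzy_transportV p q M : rauzy_transport p q M -> rauzy_transport q p (invmx M).
Proof.
move=> [uM Mpq Qpq]; split; first by rewrite unitmx_inv.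
  by rewrite -Mpq !mulmxA mulVmx // mul1mx -mulmxA -trmx_mul mulVmx // trmx1 mulmx1.
by move=> u; rewrite -Qpq -mulmxA !mod2E -rmod2M mulVmx // rmod2_1 mulmx1.
Qed.

Lemma rauzy_transport1 p : rauzy_transport p p 1%:M.
Proof.
split; rewrite ?unitmx1 ?mul1mx ?trmx1 ?mulmx1 // => u.
by rewrite mod2E rmod2_1 mulmx1.
Qed.

Hypothesis n_gt1 : (1 < n)%N.

Lemma arrow_winner p q w l : rauzy_arrow p q w l -> w != l.
Proof.
by elim/arrow_ind => // {}p {}q {}w {}l; apply: top_step_winner.
Qed.

Lemma irreducible_arrow p q w l : rauzy_arrow p q w l -> perm_irreducible q.
Proof.
elim/arrow_ind => {p q w l} [p q w l|p q w l]; first exact: irreducible_top_step.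
by rewrite irreducible_iswap.
Qed.

Lemma arrow_Omega p q w l : rauzy_arrow p q w l ->
  Bmx w l *m Omega p *m (Bmx w l)^T = Omega q.
Proof.
elim/arrow_ind => {p q w l} [p q w l|p q w l]; first exact: top_step_Omega.
by rewrite !Omega_iswap mulmxN mulNmx => /oppr_inj.
Qed.

(** Winner and loser cross, so [Q] takes the value 1 at [e l + e w], as [Qform_transport]
    demands. *)
Lemma arrow_Omega_wl p q w l : rauzy_arrow p q w l -> ~~ (2 %| Omega p l w)%Z.
Proof.
elim/arrow_ind => {p q w l} [p q w l st|p q w l]; last first.
  rewrite Omega_iswap; have -> : (- Omega p) l w = - (Omega p l w) by rewrite [LHS]mxE.
  by clear; lia.
have /top_stepP[ip pw pl _ _] := st.
have := irreducible_last n_gt1 ip pw; have := pt_lt p l.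
have : pt p l <> pt p w by move/pt_inj/eqP; rewrite eq_sym (negbTE (top_step_winner n_gt1 st)).
by rewrite OmegaE pw pl; clear; lia.
Qed.

Lemma arrow_transport p q w l : rauzy_arrow p q w l -> rauzy_transport p q (Bmx w l).
Proof.
move=> ar; split; [exact/Bmx_unit/(arrow_winner ar) | exact: arrow_Omega | ].
apply: Qform_transport => [|i]; first exact: arrow_Omega.
have -> : delta_mx 0 i *m mod2 (Bmx w l) = delta_mx 0 i + (delta_mx 0 w *+ (i == l) : 'rV_n).
  by rewrite mod2E rmod2D rmod2_1 rmod2_delta mulmxDr mulmx1 mul_delta_mx_cond.
have [->|_] := eqVneq i l; last by rewrite addr0 Qform_delta.
rewrite mulr1n Qform_D !Qform_delta trmx_delta -rowE -colE 3!mxE.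
have := arrow_Omega_wl ar; rewrite -intr_F2.
by case: (F2_cases (Omega p l w)%:~R) => -> // _; apply: val_inj.
Qed.

Lemma walk_transport p q M : rauzy_walk p q M -> rauzy_transport p q M.
Proof.
elim => [|{}q r w l {}M _ IH ar|{}q r w l {}M _ IH ar]; first exact: rauzy_transport1.
  exact: rauzy_transportM IH (arrow_transport ar).
exact: rauzy_transportM IH (rauzy_transportV (arrow_transport ar)).
Qed.

Lemma walk_cat p q r M N : rauzy_walk p q M -> rauzy_walk q r N -> rauzy_walk p r (N *m M).
Proof.
move=> wM; elim => [|s t w l {}N _ IH ar|s t w l {}N _ IH ar]; first by rewrite mul1mx.
  by rewrite -mulmxA; apply: rwalk_fwd IH ar.
by rewrite -mulmxA; apply: rwalk_bwd IH ar.
Qed.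

Lemma walk_arrow p q w l : rauzy_arrow p q w l -> rauzy_walk p q (Bmx w l).
Proof. by move=> ar; rewrite -[Bmx w l]mulmx1; apply: rwalk_fwd ar; apply: rwalk_nil. Qed.

Lemma walk_arrowV p q w l : rauzy_arrow p q w l -> rauzy_walk q p (invmx (Bmx w l)).
Proof. by move=> ar; rewrite -[invmx _]mulmx1; apply: rwalk_bwd ar; apply: rwalk_nil. Qed.

Lemma walk_inv p q M : rauzy_walk p q M -> rauzy_walk q p (invmx M).
Proof.
have inv_mul (X Y : 'M[int]_n) : X \in unitmx -> Y \in unitmx ->
    invmx (X *m Y) = invmx Y *m invmx X.
  move=> uX uY; apply: mulmx1_inv.
  by rewrite mulmxA -(mulmxA X) mulmxV // mulmx1 mulmxV.
elim => [|{}q r w l {}M wM IH ar|{}q r w l {}M wM IH ar].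
- by rewrite invmx1; apply: rwalk_nil.
- have [uM _ _] := walk_transport wM; rewrite inv_mul ?(Bmx_unit (arrow_winner ar)) //.
  exact: walk_cat (walk_arrowV ar) IH.
have [uM _ _] := walk_transport wM.
rewrite inv_mul ?unitmx_inv ?(Bmx_unit (arrow_winner ar)) // invmxK.
exact: walk_cat (walk_arrow ar) IH.
Qed.

Lemma RV_conj p q M S : rauzy_walk p q M -> RV q S -> RV p (invmx M *m (S *m M)).
Proof.
move=> wM wS; apply: walk_cat (walk_inv wM); exact: walk_cat wM wS.
Qed.

End Rauzy.

(** * Cycles of Rauzy operations and transvections along letters *)

Section RauzyDynamics.
Variable n : nat.
Hypothesis n_gt1 : 1 < n.
Implicit Types (p q r : iperm n) (a b l w : 'I_n).

Definition rarrow p q : bool := [exists w, exists l, rauzy_arrow p q w l].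
Definition reach p q : bool := connect rarrow p q.

Lemma rarrowP p q : reflect (exists w l, rauzy_arrow p q w l) (rarrow p q).
Proof.
apply: (iffP existsP) => [[w /existsP[l ar]]|[w [l ar]]]; first by exists w, l.
by exists w; apply/existsP; exists l.
Qed.

Lemma reach_arrow p q w l : rauzy_arrow p q w l -> reach p q.
Proof. by move=> ar; apply/connect1/rarrowP; exists w, l. Qed.

Lemma reach_ind p (P : iperm n -> Prop) : P p ->
  (forall q r w l, reach p q -> P q -> rauzy_arrow q r w l -> P r) ->
  forall q, reach p q -> P q.
Proof.
move=> Pp Pstep q /connectP[s].
elim/last_ind: s q => [|s r IH] q /=; first by move=> _ ->.
rewrite rcons_path last_rcons => /andP[ps /rarrowP[w [l ar]]] ->.
by apply: (Pstep (last p s) _ w l) => //; [apply/connectP; exists s | apply: IH].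
Qed.

Lemma reach_iswap p q : reach p q -> reach (iswap p) (iswap q).
Proof.
elim/reach_ind => [|{}q r w l _ IH ar]; first exact: connect0.
by apply: connect_trans IH _; apply: (@reach_arrow _ _ w l); rewrite rauzy_arrow_iswap.
Qed.

Lemma reach_irreducible p q : perm_irreducible p -> reach p q -> perm_irreducible q.
Proof. by move=> ip; elim/reach_ind => // {}q r w l _ _; apply: irreducible_arrow. Qed.

Lemma last_top p : exists w, pt p w = n.-1.
Proof.
have n0 : n.-1 < n by move: n_gt1; clear; lia.
by exists (p.1^-1 (Ordinal n0))%g; rewrite /pt permKV.
Qed.

Lemma last_bot p : exists l, pb p l = n.-1.
Proof. exact: last_top (iswap p). Qed.

Lemma rshift_lt k x : k < n.-1 -> x < n -> rshift n k x < n.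
Proof. by rewrite /rshift; clear; intros; repeat case: ifP => ?; lia. Qed.

Lemma rshift_inj k x y : k < n.-1 -> x < n -> y < n ->
  rshift n k x = rshift n k y -> x = y.
Proof. by rewrite /rshift; clear; move=> ? ? ?; repeat case: ifP => ?; lia. Qed.

Lemma top_step_ex p w : perm_irreducible p -> pt p w = n.-1 ->
  exists q l, top_step p q w l.
Proof.
move=> ip pw; have lt := irreducible_last n_gt1 ip pw.
pose f a : 'I_n := Ordinal (rshift_lt lt (pb_lt p a)).
have f_inj : injective f.
  by move=> a b /(congr1 val)/= /(rshift_inj lt (pb_lt p a) (pb_lt p b))/pb_inj.
have [l pl] := last_bot p.
exists (p.1, perm f_inj), l; apply/top_stepP; split=> // a.
by rewrite /pb /= permE.
Qed.

(* The position of the letter at [x] after [i] top operations whose winner sits at [k]. *)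
Definition rotate_after k i x : nat :=
  if x <= k then x else if x + i < n then x + i else x + i - (n.-1 - k).

Lemma rotate_afterS k i x : k < n.-1 -> x < n -> i < n.-1 - k ->
  rshift n k (rotate_after k i x) = rotate_after k i.+1 x.
Proof.
clear; move=> ltk ltx lti; rewrite /rotate_after; case: ifP => xk.
  by rewrite /rshift xk.
by case: ifP => xi; rewrite /rshift; repeat case: ifP => ?; lia.
Qed.

Lemma rotate_after_full k x : k < n.-1 -> x < n -> rotate_after k (n.-1 - k) x = x.
Proof. by clear; move=> ltk ltx; rewrite /rotate_after; repeat case: ifP => ?; lia. Qed.

(** The product of the first [i] arrow matrices: the letters in the last [i] bottom positions have
    each lost once to [w]. *)
Definition top_cycle_mx p w (i : nat) : 'M[int]_n :=
  (\matrix_(a, j) ((a == j)%:R + ((n - i <= pb p a)%N && (j == w))%:R))%R.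

Lemma top_iterate p w i : perm_irreducible p -> pt p w = n.-1 -> i <= n.-1 - pb p w ->
  exists q, [/\ reach p q, rauzy_walk p q (top_cycle_mx p w i), q.1 = p.1 &
    forall a, pb q a = rotate_after (pb p w) i (pb p a)].
Proof.
move=> ip pw; have lt := irreducible_last n_gt1 ip pw.
elim: i => [_|i IH lei].
  exists p; split=> //; first exact: connect0.
    have -> : top_cycle_mx p w 0 = 1%:M%R; last exact: rwalk_nil.
    apply/matrixP => a j; rewrite !mxE subn0 leqNgt pb_lt addr0.
    by case: (a == j).
  by move=> a; rewrite /rotate_after addn0 pb_lt; case: ifP.
have [|q [pq wq q1 q2]] := IH; first by apply: ltnW.
have iq := reach_irreducible ip pq.
have qw : pt q w = n.-1 by rewrite /pt q1.
have [r [l st]] := top_step_ex iq qw.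
have ar : rauzy_arrow q r w l by rewrite /rauzy_arrow st.
have /top_stepP[_ _ ql r1 r2] := st.
have qkw : pb q w = pb p w by rewrite q2 /rotate_after leqnn.
exists r; split.
- exact: connect_trans pq (reach_arrow ar).
- have -> : top_cycle_mx p w i.+1 = (Bmx w l *m top_cycle_mx p w i)%R; last exact: rwalk_fwd wq ar.
  apply/matrixP => a j; rewrite mul_Bmx !mxE.
  have wi : (n - i <= pb p w) = false by move: lei lt; clear; lia.
  (* The loser of the next operation is the letter that started at position [n.-1 - i]. *)
  have al : (pb p a == n.-1 - i) = (a == l).
    apply/eqP/eqP => [pa|->].
      apply: (@pb_inj _ q); rewrite ql q2 pa /rotate_after; move: lei lt; clear.
      by intros; repeat case: ifP => ?; lia.
    move: ql lei lt (pb_lt p l); rewrite q2 /rotate_after; clear.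
    by intros; move: ql; repeat case: ifP => ?; lia.
  rewrite wi /= addr0 -al (eq_sym w j).
  have -> : (n - i.+1 <= pb p a) = (n - i <= pb p a) || (pb p a == n.-1 - i).
    by move: lei lt; clear; lia.
  have : ~~ ((n - i <= pb p a) && (pb p a == n.-1 - i)) by move: lei lt; clear; lia.
  by case: (n - i <= pb p a); case: (pb p a == _); case: (a == j); case: (j == w).
- by rewrite r1.
by move=> a; rewrite r2 qkw q2 rotate_afterS // pb_lt.
Qed.

Local Notation Tv p a := (transv_mx (Omega p) 1%R (delta_mx 0%R a)).

Lemma tv_delta p w a j :
  (Tv p w a j = (a == j)%:R + (Omega p a w) *+ (j == w))%R.
Proof.
rewrite /transv_mx scale1r trmx_delta -colE; set C := col w _; rewrite !mxE big_ord1 !mxE eqxx.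
by rewrite /= mulr_natr.
Qed.

(** After [n.-1 - pb p w] operations the permutation is back to [p]. Each letter right of [w] on the
    bottom has lost once, and since [w] is last on top these are exactly the letters crossing
    [w]. *)
Lemma RV_top_last p w : perm_irreducible p -> pt p w = n.-1 -> RV p (Tv p w).
Proof.
move=> ip pw; have lt := irreducible_last n_gt1 ip pw.
have [q [_ wq q1 q2]] := top_iterate ip pw (leqnn _).
have qp : q = p.
  have e2 : q.2 = p.2.
    apply/permP => a; apply: val_inj; rewrite -/(pb q a) -/(pb p a) q2.
    by rewrite rotate_after_full // pb_lt.
  by case: q p q1 e2 {ip pw wq lt q2} => [q1 q2] [p1 p2] /= -> ->.
have -> : Tv p w = top_cycle_mx p w (n.-1 - pb p w); last by move: wq; rewrite qp.
apply/matrixP => a j; rewrite tv_delta OmegaE mxE; congr (_ + _)%R.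
have -> : (n - (n.-1 - pb p w) <= pb p a) = (pb p w < pb p a) by move: lt; clear; lia.
have -> : (pt p w < pt p a) = false by rewrite pw; have := pt_lt p a; clear; lia.
rewrite subr0.
by case: (pb p w < pb p a); case: (j == w).
Qed.

Lemma tv_iswap p a k :
  transv_mx (Omega (iswap p)) k (delta_mx 0%R a) = transv_mx (Omega p) (- k)%R (delta_mx 0%R a).
Proof. by rewrite /transv_mx Omega_iswap !mulNmx scalerN scaleNr. Qed.

Lemma walk_iswap p q M : rauzy_walk p q M -> rauzy_walk (iswap p) (iswap q) M.
Proof.
elim => [|{}q r w l {}M _ IH ar|{}q r w l {}M _ IH ar]; first exact: rwalk_nil.
  by apply: rwalk_fwd IH _; rewrite rauzy_arrow_iswap.
by apply: rwalk_bwd IH _; rewrite rauzy_arrow_iswap.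
Qed.

Definition is_last p a : bool := (pt p a == n.-1) || (pb p a == n.-1).

Lemma RV_last p a : perm_irreducible p -> is_last p a -> RV p (Tv p a).
Proof.
move=> ip /orP[/eqP|] la; first exact: RV_top_last.
have := @RV_top_last (iswap p) a; rewrite irreducible_iswap tv_iswap => /(_ ip (eqP la)).
(* Exchanging the rows negates [Omega], hence inverts the transvection. *)
by move/walk_iswap/(walk_inv n_gt1); rewrite iswapK tv_inv ?Omega_skew // opprK.
Qed.

(** The transvection is pulled back along the path. A letter that is not last before an arrow is not
    its loser, so the arrow matrix fixes [e a] and conjugates one transvection to the other; a
    letter that is last falls under [RV_last]. *)
Lemma RV_reach p q a : perm_irreducible p -> reach p q -> is_last q a -> RV p (Tv p a).
Proof.
move=> ip pq la.
suff: RV q (Tv q a) -> RV p (Tv p a) by apply; apply: RV_last la; apply: reach_irreducible pq.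
elim/reach_ind: pq {la} => // {}q r w l pq IH ar Tr; apply: IH.
have [la|nla] := boolP (is_last q a); first exact: (RV_last (reach_irreducible ip pq)).
have al : a != l.
  apply: contraNneq nla => ->; rewrite /is_last.
  by case/orP: ar => /and5P[_ _ /eqP-> _ _]; rewrite eqxx ?orbT.
have := RV_conj n_gt1 (walk_arrow ar) Tr; congr (rauzy_walk _ _).
have [uB BO _] := arrow_transport n_gt1 ar.
have aB : ((delta_mx 0 a : 'rV_n) *m Bmx w l = delta_mx 0 a)%R.
  by rewrite /Bmx mulmxDr mulmx1 mul_delta_mx_cond (negbTE al) mulr0n addr0.
apply: mx_act_inj => u; rewrite !mulmxA !mulmx_tv mulmxDl mulmxKV // -scalemxAl aB.
congr (_ + (_ * _) *: _)%R.
rewrite /bform -BO !mulmxA mulmxKV // -!mulmxA -trmx_mul.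
by rewrite aB.
Qed.

Lemma reach_right p w a : perm_irreducible p -> pt p w = n.-1 -> pb p w < pb p a ->
  exists q, [/\ reach p q, q.1 = p.1 & pb q a = n.-1].
Proof.
move=> ip pw wa.
have [|q [pq _ q1 q2]] := top_iterate (i := n.-1 - pb p a) ip pw; first by move: wa; clear; lia.
exists q; split=> //; rewrite q2 /rotate_after leqNgt wa /=.
by have := pb_lt p a; clear => h; rewrite ifT; lia.
Qed.

Definition never_last p a : bool := [forall q, reach p q ==> ~~ is_last q a].

Lemma never_last_reach p q a : reach p q -> never_last p a -> never_last q a.
Proof.
move=> pq /forallP np; apply/forallP => r; apply/implyP => qr.
by have /implyP := np r; apply; apply: connect_trans pq qr.
Qed.

(** A letter right of the winner would be rotated to the last bottom position. *)
Lemma never_last_left p w a : perm_irreducible p -> never_last p a -> pt p w = n.-1 ->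
  pb p a < pb p w.
Proof.
move=> ip na pw; have lt := irreducible_last n_gt1 ip pw.
have aw : a != w.
  apply: contraTneq na => ->; apply/negP => /forallP/(_ p).
  by rewrite /reach connect0 /is_last pw eqxx.
rewrite ltn_neqAle; apply/andP; split.
  by apply: contraNneq aw => /pb_inj ->.
rewrite leqNgt; apply/negP => wa.
have [q [pq _ qa]] := reach_right ip pw wa.
by have /forallP/(_ q) := na; rewrite pq /is_last qa eqxx orbT.
Qed.

Lemma reach_iswapE p q : reach (iswap p) (iswap q) = reach p q.
Proof.
apply/idP/idP; last exact: reach_iswap.
by move/reach_iswap; rewrite !iswapK.
Qed.

Lemma never_last_iswap p a : never_last p a -> never_last (iswap p) a.
Proof.
move=> /forallP np; apply/forallP => q; apply/implyP => pq.
have := np (iswap q); rewrite -reach_iswapE iswapK pq.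
by rewrite /is_last orbC.
Qed.

Lemma never_last_arrow p q w l a x : rauzy_arrow p q w l -> never_last p a ->
  ((pt q a < pt q x) = (pt p a < pt p x)) * ((pb q a < pb q x) = (pb p a < pb p x)).
Proof.
elim/arrow_ind => {p q w l} [p q w l st|p q w l IH] na; last first.
  by have [? ?] := IH (never_last_iswap na); split.
have /top_stepP[ip pw pl q1 q2] := st.
have lt := never_last_left ip na pw; have ltw := irreducible_last n_gt1 ip pw.
split; first by rewrite /pt q1.
rewrite !q2 /rshift; have := pb_lt p x; move: lt ltw; clear.
by intros; repeat case: ifP => ?; lia.
Qed.

(** At a permutation where [x] is last in some row, [a] precedes it in both rows; by
    [never_last_arrow] their relative order is the same at [p]. *)
Lemma never_last_lt p a x : perm_irreducible p -> never_last p a -> ~~ never_last p x ->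
  pt p a < pt p x /\ pb p a < pb p x.
Proof.
move=> ip na; rewrite negb_forall => /existsP[q]; rewrite negb_imply negbK => /andP[pq lx].
have inv : (pt q a < pt q x) = (pt p a < pt p x) /\ (pb q a < pb q x) = (pb p a < pb p x).
  elim/reach_ind: pq {lx} => // {}q r w l pq [<- <-] ar.
  by have [? ?] := never_last_arrow x ar (never_last_reach pq na).
have nqa := never_last_reach pq na; have iq := reach_irreducible ip pq.
have : ~~ is_last q a by have /forallP/(_ q) := nqa; rewrite /reach connect0.
rewrite /is_last negb_or => /andP[ta ba]; have := pt_lt q a; have := pb_lt q a.
case: inv => <- <- lb ltt; case/orP: lx => /eqP lx.
  by have := never_last_left iq nqa lx; move: ta ba lb ltt; rewrite lx; clear; lia.
have isq : perm_irreducible (iswap q) by rewrite irreducible_iswap.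
have h : pt q a < pt q x := never_last_left isq (never_last_iswap nqa) lx.
by move: h ta ba lb ltt; rewrite lx; clear; lia.
Qed.

Lemma card_perm_lt (s : {perm 'I_n}) (j : nat) : j <= n -> #|[set a | val (s a) < j]| = j.
Proof.
move=> jn; have -> : [set a | val (s a) < j] = s @^-1: [set a : 'I_n | val a < j].
  by apply/setP => a; rewrite !inE.
rewrite card_preimset; last exact: perm_inj.
rewrite -sum1_card (eq_bigl (fun a : 'I_n => a < j)) => [|a]; last by rewrite inE.
by rewrite -(big_ord_widen n (fun=> 1)) // sum1_card card_ord.
Qed.

(** The letters that are never last would fill the same proper initial segment of both rows, against
    irreducibility. *)
Lemma never_lastF p a : perm_irreducible p -> never_last p a = false.
Proof.
move=> ip; apply/negP => na.
pose R := [set x | never_last p x].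
have aR : a \in R by rewrite inE.
have segm (s : {perm 'I_n}) : (forall x y, x \in R -> y \notin R -> val (s x) < val (s y)) ->
    R = [set x | val (s x) < #|R|].
  move=> sR; have [m mR mmax] := @arg_maxnP _ a (mem R) (fun x => val (s x)) aR.
  have RE : R = [set x | val (s x) < (val (s m)).+1].
    apply/setP => x; rewrite [RHS]inE ltnS; apply/idP/idP => [/mmax //|le].
    by apply: contraLR le => xR; rewrite -ltnNge sR.
  have cR : #|R| = (val (s m)).+1 by rewrite RE card_perm_lt ?ltn_ord.
  by rewrite cR.
have lt2 x y : x \in R -> y \notin R -> pt p x < pt p y /\ pb p x < pb p y.
  by rewrite !inE => nx ny; apply: never_last_lt.
have R1 := segm p.1 (fun x y hx hy => (lt2 x y hx hy).1).
have R2 := segm p.2 (fun x y hx hy => (lt2 x y hx hy).2).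
have Rn : #|R| < n.
  have [w pw] := last_top p.
  rewrite -[ltnRHS]card_ord; apply: proper_card; apply/properP; split; first exact/subsetP.
  exists w => //; rewrite inE; apply/negP => /forallP/(_ p).
  by rewrite /reach connect0 /is_last pw eqxx.
have /forallP/(_ (Ordinal Rn)) := ip.
by rewrite /= card_gt0 -R1 -R2 eqxx implybF; apply/negP; rewrite negbK; apply/set0Pn; exists a.
Qed.

Lemma reach_last p a : perm_irreducible p -> exists2 q, reach p q & is_last q a.
Proof.
move=> ip; have := never_lastF a ip; rewrite /never_last => /negbT.
by rewrite negb_forall => /existsP[q]; rewrite negb_imply negbK => /andP[? ?]; exists q.
Qed.

Lemma RV_transv p a : perm_irreducible p -> RV p (Tv p a).
Proof. by move=> ip; have [q pq la] := reach_last a ip; apply: RV_reach pq la. Qed.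

End RauzyDynamics.

(** * Standard permutations and the main theorem *)

Section Standard.
Variable n : nat.
Hypothesis n_gt1 : 1 < n.
Implicit Types (p q r : iperm n) (a b l w : 'I_n).

Lemma reach_first p q a : reach p q -> pt p a = 0 -> pt q a = 0.
Proof.
elim/reach_ind => // {}q r w l _ IH /orP[/and5P[_ _ _ /eqP q1 _]|/and5P[_ _ _ _ /forallP r2]] /IH qa.
  by rewrite /pt q1.
by have /eqP -> := r2 a; rewrite qa /rshift leq0n.
Qed.

(** The first letters of the two rows never change. The first top letter [a] can be made last in
    some row, necessarily the bottom one; operations with winner [a] then rotate the first bottom
    letter [z] to the end of the top row. *)
Lemma standard_ex p : perm_irreducible p ->
  exists q a z, [/\ reach p q, pt q a = 0, pb q a = n.-1, pt q z = n.-1 & pb q z = 0].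
Proof.
move=> ip; have n_gt0 : 0 < n by apply: ltnW.
have first r : exists a, pt r a = 0.
  by exists (r.1^-1 (Ordinal n_gt0))%g; rewrite /pt permKV.
have [[a pa] [z pz]] := (first p, first (iswap p)).
have [q pq la] := reach_last n_gt1 a ip.
have qa : pt q a = 0 := reach_first pq pa.
have qz : pb q z = 0 := reach_first (reach_iswap pq) pz.
have qla : pb q a = n.-1.
  by case/orP: la => /eqP //; rewrite qa; move: n_gt1; clear; lia.
have iq : perm_irreducible (iswap q).
  by rewrite irreducible_iswap; apply: reach_irreducible pq.
have az : pb (iswap q) a < pb (iswap q) z.
  change (pt q a < pt q z); rewrite qa lt0n -qa; apply/eqP => /pt_inj e.
  by move: qla n_gt1; rewrite -e qz; clear; lia.
have [r [qr r1 rz]] := reach_right n_gt1 iq (qla : pt (iswap q) a = n.-1) az.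
exists (iswap r), a, z; split=> //.
- by apply: connect_trans pq _; have := reach_iswap qr; rewrite iswapK.
- exact: reach_first (reach_iswap qr) _.
- by rewrite -qla /pb /= r1.
- by rewrite -qz /pb /= r1.
Qed.

Lemma reach_class p q : reach p q -> rauzy_class p q.
Proof.
elim/reach_ind => [|{}q r w l _ IH ar]; first exact: connect0.
apply: connect_trans IH (connect1 _); apply/existsP; exists w; apply/existsP; exists l.
by rewrite ar.
Qed.

Lemma reach_walk p q : reach p q -> exists M, rauzy_walk p q M.
Proof.
elim/reach_ind => [|{}q r w l _ [M wM] ar]; first by exists 1%:M%R; apply: rwalk_nil.
by exists (Bmx w l *m M)%R; apply: rwalk_fwd ar.
Qed.

(** If all pairs cross, the letters before [a] on the bottom are exactly those after [a] on top, and
    counting them shows that [p] is symmetric. *)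
Lemma noncrossing_pair p : ~~ symmetric_perm p ->
  exists a b, a != b /\ Omega p a b = 0%R.
Proof.
move=> ns.
have [/existsP[a /existsP[b /andP[ab /eqP O0]]]|none] :=
  boolP [exists a, [exists b, (a != b) && (Omega p a b == 0%R)]]; first by exists a, b.
case/negP: ns; apply/forallP => a; apply/eqP.
rewrite -[LHS](card_perm_lt p.2 (ltnW (pb_lt p a))).
have -> : [set b | val (p.2 b) < pb p a] = ~: [set b | val (p.1 b) < (pt p a).+1].
  apply/setP => b; rewrite !inE -/(pb p b) -/(pt p b) -leqNgt.
  have [->|ab] := eqVneq b a; first by rewrite !ltnn.
  move: none; rewrite negb_exists => /forallP/(_ a); rewrite negb_exists => /forallP/(_ b).
  rewrite eq_sym ab OmegaE /=.
  have nt : pt p b <> pt p a by move/pt_inj; apply/eqP.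
  by move: nt; clear; lia.
by rewrite cardsCs setCK card_ord card_perm_lt ?pt_lt //; move: (pt_lt p a); clear; lia.
Qed.

Lemma Omega_first p a i : pt p a = 0 -> pb p a = n.-1 -> i != a -> Omega p a i = 1%R.
Proof.
move=> pa qa ia; rewrite OmegaE pa qa ltn0 subr0 ltn_neqAle -qa.
rewrite (_ : pb p i != pb p a) /=; first by rewrite qa; have := pb_lt p i; case: leqP => //; clear; lia.
by apply: contraNneq ia => /pb_inj ->.
Qed.

Lemma Omega_last p z i : pt p z = n.-1 -> pb p z = 0 -> i != z -> Omega p z i = (-1)%R.
Proof.
move=> pz qz iz; have := @Omega_first (iswap p) z i qz pz iz.
rewrite Omega_iswap; have -> : (- Omega p)%R z i = (- Omega p z i)%R by rewrite [LHS]mxE.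
by move/eqP; rewrite eqr_oppLR => /eqP.
Qed.

End Standard.

(** * Unimodularity of a nondegenerate intersection form *)

Section Unimodular.
Local Open Scope ring_scope.
Variables (n : nat) (p : iperm n).
Hypothesis det_n0 : \det (Omega p) != 0.
Local Notation d := (\det (Omega p)).

(** Membership in the lattice spanned by the rows of [Omega p], tested by Cramer's rule. *)
Definition in_lattice (v : 'rV[int]_n) : bool := [forall i, (d %| (v *m \adj (Omega p))%R 0%R i)%Z].

Lemma in_latticeD u v : in_lattice u -> in_lattice v -> in_lattice (u + v).
Proof.
move=> /forallP hu /forallP hv; apply/forallP => i.
by rewrite mulmxDl mxE rpredD.
Qed.

Lemma in_latticeN u : in_lattice u -> in_lattice (- u).
Proof.
move=> /forallP hu; apply/forallP => i.
by rewrite mulNmx mxE rpredN.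
Qed.

Lemma in_lattice_row u : in_lattice (u *m Omega p).
Proof.
apply/forallP => i; rewrite -mulmxA mul_mx_adj mul_mx_scalar mxE.
exact: dvdz_mulr.
Qed.

Lemma in_lattice_congr u v : in_lattice (u - v) -> in_lattice u = in_lattice v.
Proof.
move=> huv; apply/idP/idP => h; last by rewrite -(subrK v u); apply: in_latticeD.
by rewrite -(subKr u v); apply: in_latticeD => //; apply: in_latticeN.
Qed.

Definition initial (s : {perm 'I_n}) (j : nat) : 'rV[int]_n := \row_b (val (s b) < j)%N%:Z.

Lemma initialS s a : initial s (val (s a)).+1 = initial s (val (s a)) + delta_mx 0 a.
Proof.
apply/rowP => b; rewrite !mxE /= ltnS leq_eqVlt.
have -> : (b == a) = (val (s b) == val (s a)) by rewrite (inj_eq val_inj) (inj_eq perm_inj).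
by case: ltngtP.
Qed.

Lemma initial_row a : initial p.2 (val (p.2 a)) - initial p.1 (val (p.1 a)) = delta_mx 0 a *m Omega p.
Proof. by apply/rowP => b; rewrite -rowE [RHS]mxE OmegaE !mxE. Qed.

Lemma telescope_perm (s : {perm 'I_n}) (f : nat -> int) j : (j <= n)%N ->
  \sum_(b | (val (s b) < j)%N) (f (val (s b)).+1 - f (val (s b))) = f j - f 0%N.
Proof.
move=> jn; rewrite -(reindex_inj (P := fun b : 'I_n => (val b < j)%N)
  (F := fun b : 'I_n => f (val b).+1 - f (val b)) (@perm_inj _ s)) /=.
by rewrite -(big_ord_widen _ (fun b => f b.+1 - f b) jn)
  -(big_mkord predT (fun b => f b.+1 - f b)) telescope_sumr.
Qed.

(* If some initial indicator vector were outside the row lattice, the jumps of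
   the indicator of "lying in the lattice" would give a kernel vector of [Omega p]. *)
Lemma Omega_unimodular : Omega p \in unitmx.
Proof.
pose f s j : int := (in_lattice (initial s j))%:Z.
(* The initial segments ending just before [a] in the two rows differ by row [a] of [Omega p], so
   both or neither lie in the lattice. *)
have f12 a : f p.1 (val (p.1 a)) = f p.2 (val (p.2 a)).
  rewrite /f; congr (nat_of_bool _)%:Z; apply/esym/in_lattice_congr.
  by rewrite initial_row in_lattice_row.
have f12S a : f p.1 (val (p.1 a)).+1 = f p.2 (val (p.2 a)).+1.
  rewrite /f; congr (nat_of_bool _)%:Z; apply/esym/in_lattice_congr.
  by rewrite !initialS opprD addrACA subrr addr0 initial_row in_lattice_row.
pose lam : 'cV[int]_n := \col_a (f p.1 (val (p.1 a)).+1 - f p.1 (val (p.1 a))).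
have f0 s : f s 0%N = 1.
  rewrite /f (_ : initial s 0 = 0 *m Omega p) ?in_lattice_row //.
  by rewrite mul0mx; apply/rowP => b; rewrite !mxE.
have Olam : Omega p *m lam = 0.
  apply/colP => a; rewrite !mxE.
  (* [lam] records the jumps of [f] along either row, so both sums telescope, and their end values
     agree by [f12]. *)
  have -> : \sum_j Omega p a j * lam j 0 =
      \sum_(j | (val (p.2 j) < val (p.2 a))%N) (f p.2 (val (p.2 j)).+1 - f p.2 (val (p.2 j))) -
      \sum_(j | (val (p.1 j) < val (p.1 a))%N) (f p.1 (val (p.1 j)).+1 - f p.1 (val (p.1 j))).
    rewrite [X in _ = X - _]big_mkcond [X in _ = _ - X]big_mkcond -sumrB.
    apply: eq_bigr => j _; rewrite OmegaE mxE -f12 -f12S /pt /pb /=.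
    by case: ifP; case: ifP => _ _; rewrite ?mulr0 ?mul0r ?sub0r ?subr0 ?subrr ?mul1r ?mulN1r ?mul0r.
  by rewrite !telescope_perm ?(ltnW (ltn_ord _)) // !f0 f12 subrr.
have lam0 : lam = 0.
  have := congr1 (mulmx (\adj (Omega p))) Olam.
  rewrite mulmxA mul_adj_mx mulmx0 mul_scalar_mx => /colP e; apply/colP => a.
  by have /eqP := e a; rewrite [in X in X -> _]mxE [X in _ == X]mxE mulf_eq0
    (negbTE det_n0) /= [RHS]mxE => /eqP.
have f1 j : (j <= n)%N -> f p.1 j = 1.
  elim: j => [|j IH] jn; first exact: f0.
  rewrite -(IH (ltnW jn)); have /colP/(_ (p.1^-1 (Ordinal jn))%g) := lam0.
  by rewrite !mxE permKV /= => /eqP; rewrite subr_eq0 => /eqP.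
have inl j : (j <= n)%N -> in_lattice (initial p.1 j).
  by move=> /f1; rewrite /f; case: in_lattice.
(* Consecutive initial vectors differ by a basis vector, so the row lattice is everything. *)
have ine a : in_lattice (delta_mx 0 a).
  have -> : delta_mx 0 a = initial p.1 (val (p.1 a)).+1 - initial p.1 (val (p.1 a)).
    by rewrite initialS addrC addKr.
  by apply: in_latticeD; [apply/inl/ltn_ord | apply/in_latticeN/inl/ltnW/ltn_ord].
pose U := \matrix_(i, j) (\adj (Omega p) i j %/ d)%Z.
have adjU : \adj (Omega p) = d *: U.
  apply/matrixP => i j; rewrite [RHS]mxE [X in _ * X]mxE mulrC divzK //.
  by have /forallP/(_ j) := ine i; rewrite -rowE mxE.
have OU : Omega p *m U = 1%:M.
  apply/matrixP => i j; apply: (mulfI det_n0).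
  have e : d *: (Omega p *m U) = d *: 1%:M by rewrite scalemxAr -adjU mul_mx_adj scalemx1.
  by move/matrixP/(_ i j): e; rewrite [LHS]mxE [RHS]mxE.
exact: (mulmx1_unit OU).1.
Qed.

End Unimodular.

(** * Standard permutations and conjugation back to the given one *)

Section Main.
Local Open Scope ring_scope.

Lemma RV_standard n (q : iperm n) a z :
  (4 < n)%N -> perm_irreducible q -> \det (Omega q) != 0 -> ~~ symmetric_perm q ->
  pt q a = 0%N -> pb q a = n.-1 -> pt q z = n.-1 -> pb q z = 0%N ->
  forall S, in_Sp q S -> (forall u, Qform q (u *m mod2 S) = Qform q u) -> RV q S.
Proof.
move=> n4 iq dq nsq ta ba tz bz S spS QS.
have n1 : (1 < n)%N by apply: ltn_trans n4.
have az : a != z by apply/eqP => e; move: ta tz; rewrite e => -> /eqP; move: n1; clear; lia.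
have OA i : i != a -> Omega q a i = 1 by apply: Omega_first.
have OZ i : i != z -> Omega q z i = -1 by apply: Omega_last.
have [m1 [m2 [m12 O12]]] := noncrossing_pair nsq.
have O21 : Omega q m2 m1 = 0.
  by have /matrixP/(_ m1 m2) := Omega_skew q; rewrite [LHS]mxE [RHS]mxE O12 oppr0.
have avoid i j : i != j -> Omega q i j = 0 -> (i != a) && (i != z).
  move=> ij O0; apply/andP; split; apply: contra_eqN O0 => /eqP e.
    by rewrite e OA // -e eq_sym.
  by rewrite e OZ // -e eq_sym.
pose Q (x : 'rV['F_2]_n) := Qform q x != 0.
have F2b (x y : 'F_2) : (x + y != 0) = (x != 0) (+) (y != 0).
  by case: (F2_cases x) => ->; case: (F2_cases y) => ->.
apply: (@arithmetic_group n (Omega q) (Omega_skew q) (Omega_unimodular dq) (RV q)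
  (rwalk_nil q) (fun S1 S2 h1 h2 => walk_cat h2 h1) (fun S1 h => walk_inv n1 h)
  _ a z m1 m2 az m12 _ _ OA OZ O12 _ Q) => //.
- by move=> T /(walk_transport n1)[].
- exact: avoid O12.
- by apply: avoid O21; rewrite eq_sym.
- by move=> i; apply: RV_transv.
- by move=> x y; rewrite /Q Qform_D !F2b.
- by move=> i; rewrite /Q Qform_delta.
by move=> x; rewrite /Q QS.
Qed.

End Main.

Theorem theorem1p3 (g : nat) (p : iperm (2 * g)) :
  (3 <= g)%N ->
  perm_irreducible p -> perm_nondegenerate p ->
  minimal_stratum_perm g p ->
  ~~ hyperelliptic_class p ->
  forall S : 'M[int]_(2 * g),
    RV p S <-> (in_Sp p S /\ in_OQ p (mod2 S)).
Proof.
move=> g3 ip _ [_ dp] nhyp S.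
have n4 : (4 < 2 * g)%N by move: g3; clear; lia.
have n1 : (1 < 2 * g)%N by apply: ltn_trans n4.
split=> [wS|[spS /andP[_ /forallP QS]]].
  have [uS SO SQ] := walk_transport n1 wS; split=> //; apply/andP; split.
    have e : (mod2 S *m mod2 (invmx S) = 1%:M)%R by rewrite !mod2E -rmod2M mulmxV // rmod2_1.
    exact: (mulmx1_unit e).1.
  by apply/forallP => u; apply/eqP.
have [q [a [z [pq ta ba tz bz]]]] := standard_ex n1 ip.
have nsq : ~~ symmetric_perm q.
  by move: nhyp; rewrite negb_exists => /forallP/(_ q); rewrite reach_class.
have [M wM] := reach_walk pq.
have tM := walk_transport n1 wM; have [uM MO _] := tM.
have tS : rauzy_transport p p S.
  split; [exact: (symplectic_unit (Omega_unimodular dp) spS) | exact: spS | ].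
  by move=> u; apply/eqP.
(* The walk from [p] to [q] conjugates [S] to an isometry at the standard permutation [q]; [RV_conj]
   carries its membership back to [p]. *)
have [_ spS' QS'] := rauzy_transportM (rauzy_transportM (rauzy_transportV tM) tS) tM.
have dq : (\det (Omega q) != 0)%R.
  rewrite -MO !det_mulmx det_tr !mulf_neq0 //;
  by apply: contraTneq uM => d0; rewrite unitmxE d0 unitr0.
have wq := RV_standard n4 (reach_irreducible n1 ip pq) dq nsq ta ba tz bz spS' QS'.
have := RV_conj n1 wM wq; congr (rauzy_walk _ _).
by rewrite !mulmxA mulVmx // mul1mx -!mulmxA mulVmx // mulmx1.
Qed.
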